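(* Let $n\ge 1$, let $W$ be a Weyl group of type $B_n$, and let $c$ be a family of $W$. Let $\phi_c: Sym_n(c)\to\mathbf{B}_c$ be the bijection $\Lambda\mapsto [E_\Lambda]$, and let $Sym_n(c)^{as}=\{\Lambda\in Sym_n(c) : |S(\Lambda)|=p(c)\}$. Then $\phi_c$ restricts to a bijection $Sym_n(c)^{as}\to Con_c$. Hence $c^{as}=\{E_\Lambda : \Lambda\in Sym_n(c)^{as}\}$, where $c^{as}=\{E\in c : [E]\in Con_c\}$.
   Context: **Symbols.** $Sym_n$ ($n\ge 1$) is the set of sequences $\Lambda=(a_1,a_2,\dots,a_{2m+1})$ in $\mathbf{N}=\{0,1,2,\dots\}$ (any $m\ge 0$) such that $a_1<a_3<\cdots<a_{2m+1}$, $a_2<a_4<\cdots<a_{2m}$, $a_1+\cdots+a_{2m+1}=n+m^2$, and $0$ does not appear twice in $\Lambda$. Two elements of $Sym_n$ are equivalent if they have the same entries up to a permutation. **$S(\Lambda)$ and $p(\Lambda)$.** For $\Lambda=(a_1,\dots,a_{2m+1})\in Sym_n$ form the subsequence $a_{i_1},a_{i_2},\dots,a_{i_{2p+1}}$ ($i_1<i_2<\cdots<i_{2p+1}$) consisting of all entries $a_i$ that appear exactly once in $\Lambda$. Let $S(\Lambda)$ be the set of all $j\in[1,2p]$ such that $a_{i_j}>a_{i_{j+1}}$, and let $p(\Lambda)=p$. **Irreducible representations and families.** $W$ is the group of signed permutations of $n$ letters. Representations are finite dimensional over $\mathbf{Q}$ and $\mathrm{Irr}(W)$ is the set of irreducible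 ones up to isomorphism. There is a bijection $Sym_n\to\mathrm{Irr}(W)$, $\Lambda\mapsto E_\Lambda$: to $\Lambda$ attach the partitions $\xi$ with parts $a_{2i-1}-(i-1)$ ($1\le i\le m+1$) and $\eta$ with parts $a_{2i}-(i-1)$ ($1\le i\le m$); then $|\xi|+|\eta|=n$ and $E_\Lambda$ is the irreducible representation indexed in the usual way by the ordered bipartition $(\xi;\eta)$, i.e. induced from $W(B_{|\xi|})\times W(B_{|\eta|})$ of $\xi\boxtimes(\eta\otimes\chi)$, where $\xi,\eta$ are inflated from symmetric groups (the one-row partition giving the trivial representation) and $\chi$ is the character equal to $1$ on permutations and $-1$ on a single sign change. The families of $W$ are the sets $c=\{E_\Lambda\}$ with $\Lambda$ running over an equivalence class in $Sym_n$; this class is denoted $Sym_n(c)$. The number $p(\Lambda)$ is the same for all $\Lambda\in Sym_n(c)$ and is denoted $p(c)$. **New and constructible representations.** For $p\ge 0$ let $A_p$ be the set of sequences $(b_1,\dots,b_{2p+1})$ which are permutations of $0,1,\dots,2p$ with $b_1<b_3<\cdots<b_{2p+1}$ and $b_2<b_4<\cdots<b_{2p}$. View an element of $A_p$ as a splitting of $\{0,\dots,2p\}$ into a set $T$ of $p+1$ ''odd position'' elements and a set $B$ of $p$ ''even position'' elements. For $p\ge 1$, $i\in[0,2p-1]$ and a subset $Y\subset A_{p-1}$, let $I_i(Y)\subset A_p$ be the set of all splittings obtained as follows: take an element of $Y$, relabel $\{0,\dots,2p-2\}$ by the order preserving bijection onto $\{0,\dots,2p\}-\{i,i+1\}$,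 and then put one of $i,i+1$ into $T$ and the other into $B$ (both choices are taken, giving two elements of $A_p$ for each element of $Y$). Define collections $\mathcal{B}_p$ and $\mathcal{C}_p$ of subsets of $A_p$ by induction: $\mathcal{B}_0=\mathcal{C}_0=\{A_0\}$; for $p\ge 1$, $\mathcal{B}_p$ consists of the singleton $\{(0,1,2,\dots,2p)\}$ together with all $I_i(Y)$ with $i\in[0,2p-1]$, $Y\in\mathcal{B}_{p-1}$, and $\mathcal{C}_p$ consists of all $I_i(Y)$ with $i\in[0,2p-1]$, $Y\in\mathcal{C}_{p-1}$. Let $c$ be a family with $p(c)=p$, and let $z_0<z_1<\cdots<z_{2p}$ be the numbers appearing exactly once in the elements of $Sym_n(c)$. For $\Lambda\in Sym_n(c)$ let $\bar\Lambda\in A_p$ be the splitting for which $T$ (resp. $B$) is the set of $k$ such that $z_k$ is in an odd (resp. even) position of $\Lambda$; then $\Lambda\mapsto\bar\Lambda$ is a bijection $Sym_n(c)\to A_p$. The set $\mathbf{B}_c$ of new representations attached to $c$ consists of the representations $\bigoplus_{\Lambda\in Sym_n(c),\,\bar\Lambda\in Y}E_\Lambda$ for $Y\in\mathcal{B}_p$, and the set $Con_c\subset\mathbf{B}_c$ of constructible representations consists of those with $Y\in\mathcal{C}_p$ (these are exactly the representations of $W$ carried by the left cells contained in $c$). **The bijection $E\mapsto[E]$.** It is known (Lusztig, ''A new basis for the representation ring of a Weyl group'', 2019) that there is a unique bijection $c\to\mathbf{B}_c$, $E\mapsto[E]$, such that for every $E\in c$, $E$ appears with multiplicity $>0$ in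 $[E]$.
   Formalization: In S(Λ) the entries occurring once are kept in their own (odd or even) row and re-interleaved, rather than taken in the order of Λ; with the literal order the claim fails, e.g. n=3, class of (1,0,2,1,3), where only one symbol has |S|=p but Con_c has two elements. *)

(* Defs.v *)
From mathcomp Require Import all_boot all_order all_algebra.
From mathcomp Require Import all_fingroup all_field all_character.
From mathcomp Require Import mathcomp_extra boolp classical_sets functions.
From mathcomp Require Import cardinality fsbigop.

Set Implicit Arguments.
Unset Strict Implicit.
Unset Printing Implicit Defensive.

Import Order.TTheory GRing.Theory Num.Theory GroupScope.
Local Open Scope ring_scope.

Arguments Sym {T} S.
Arguments Sym_group {T} S.

(* Finite dimensional representations of a finite group over a field of
   characteristic 0 are represented, up to isomorphism, by their characters
   (elements of 'CF(G), with values in algC); a direct sum is a sum of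
   characters, and the multiplicity of an irreducible chi in phi is
   '[phi, chi]. *)

Section SymmetricGroup.

Variables (n : nat) (A : {set 'I_n}).

Definition fiberstab (f : 'I_n -> nat) : {set 'S_n} :=
  [set s in Sym A | [forall i, f (s i) == f i]]%SET.

Fact fiberstab_group_set f : group_set (fiberstab f).
Proof.
apply/group_setP; split=> [|s t].
  by rewrite inE group1; apply/forallP=> i; rewrite perm1.
rewrite !inE => /andP[As /forallP fs] /andP[At /forallP ft].
rewrite -[perm_on _ _]/(perm_on A (s * t)%g) perm_onM //=.
by apply/forallP=> i; rewrite permM (eqP (ft _)) (eqP (fs _)).
Qed.
Canonical fiberstab_group f := Group (fiberstab_group_set f).

(* The tableau of shape la filled with the elements of A in increasing order,
   row after row: row and column of the letter i. *)
Definition tabrow (la : seq nat) (i : 'I_n) := reshape_index la (index i (enum A)).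
Definition tabcol (la : seq nat) (i : 'I_n) := reshape_offset la (index i (enum A)).

Fact sgn_subproof (G : {group 'S_n}) :
  is_class_fun <<G>> [ffun s : 'S_n => (-1) ^+ (s : bool) *+ (s \in G)].
Proof.
rewrite genGid; apply: intro_class_fun => [s t Gs Gt | s /negPf->//].
by rewrite groupJ // Gs odd_permJ.
Qed.
Definition cfsgn (G : {group 'S_n}) : 'CF(G) := Cfun 0 (sgn_subproof G).

(* The irreducible character of the symmetric group of A indexed by the
   partition la of #|A|: the unique common constituent of Ind(1) from the row
   stabilizer and of Ind(sgn) from the column stabilizer. *)
Definition spechtchar (la : seq nat) : 'CF(Sym A) :=
  let R := fiberstab_group (tabrow la) in
  let C := fiberstab_group (tabcol la) in
  if [pick i | (i \in irr_constt ('Ind[Sym A] (1 : 'CF(R))))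
            && (i \in irr_constt ('Ind[Sym A] (cfsgn C)))] is Some i
  then 'chi[Sym A]_i else 0.

End SymmetricGroup.

Section SignedPermutations.

Variable n : nat.

(* (i, false) is the letter i and (i, true) its opposite. *)
Definition negletter (x : 'I_n * bool) := (x.1, ~~ x.2).

Fact negletterK : involutive negletter.
Proof. by case=> i b; rewrite /negletter /= negbK. Qed.

Definition WB : {group {perm 'I_n * bool}} :=
  ('C[perm (inv_inj negletterK)])%G.

Lemma WB_neg s x : s \in WB -> s (negletter x) = negletter (s x).
Proof.
move=> /cent1P c; have := congr1 (fun t : {perm _} => t x) c.
by rewrite !permM !permE.
Qed.

(* The default value 1 is used only outside of WB. *)
Definition letterperm (s : {perm 'I_n * bool}) : 'S_n :=
  insubd (1%g : 'S_n) [ffun i => (s (i, false)).1].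

Lemma WB_fst s i b : s \in WB -> (s (i, b)).1 = (s (i, false)).1.
Proof.
by case: b => // Ws; rewrite -[(i, true)]/(negletter (i, false)) WB_neg.
Qed.

Lemma WB_snd s i b : s \in WB -> (s (i, b)).2 = b (+) (s (i, false)).2.
Proof.
by case: b => // Ws; rewrite -[(i, true)]/(negletter (i, false)) WB_neg.
Qed.

Lemma letterpermE s i : s \in WB -> letterperm s i = (s (i, false)).1.
Proof.
move=> Ws; rewrite /letterperm.
have inj : injectiveb [ffun i => (s (i, false)).1].
  apply/injectiveP=> j k; rewrite !ffunE => e.
  have [e2|ne2] := eqVneq (s (j, false)).2 (s (k, false)).2.
    suff: (j, false) = (k, false) by case.
    apply: (@perm_inj _ s).
    by rewrite [LHS]surjective_pairing [RHS]surjective_pairing e e2.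
  suff: (j, false) = (k, true) by [].
  apply: (@perm_inj _ s).
  rewrite [LHS]surjective_pairing [RHS]surjective_pairing.
  rewrite (WB_fst k true Ws) (WB_snd k true Ws) e; congr pair.
  by move: ne2; case: (s (j, false)).2; case: (s (k, false)).2.
by rewrite -pvalE val_insubd inj ffunE.
Qed.

Lemma letterpermM : {in WB &, {morph letterperm : s t / (s * t)%g}}.
Proof.
move=> s t Ws Wt; apply/permP=> i.
rewrite permM !letterpermE ?groupM // permM.
by rewrite [s (i, false)]surjective_pairing WB_fst.
Qed.
Canonical letterperm_morphism := Morphism letterpermM.

Definition firstletters (k : nat) : {set 'I_n} := [set i : 'I_n | (i < k)%N]%SET.

(* W(B_k) x W(B_(n - k)), for k <= n. *)
Definition WBB (k : nat) : {group {perm 'I_n * bool}} :=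
  ('N_(WB)([set x : 'I_n * bool | x.1 \in firstletters k]%SET | 'P))%G.

(* The number of letters among the last n - k ones that s sends to the opposite
   of a letter. *)
Definition nneg (k : nat) (s : {perm 'I_n * bool}) :=
  #|[set i in ~: firstletters k | (s (i, false)).2]%SET|.

Lemma WBB_letter k s i : s \in WBB k ->
  (letterperm s i \in firstletters k) = (i \in firstletters k).
Proof.
rewrite inE => /andP[Ws /astabsP/(_ (i, false))].
by rewrite letterpermE // /= /aperm !inE.
Qed.

Lemma WBB_astabs k s : s \in WBB k ->
  letterperm s \in 'N(firstletters k | 'P)
  /\ letterperm s \in 'N(~: firstletters k | 'P).
Proof.
move=> Ps; split; apply/astabsP=> i; first exact: (WBB_letter i Ps).
by rewrite !finset.in_setC; congr (~~ _); exact: (WBB_letter i Ps).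
Qed.

Lemma nneg_sign k s : s \in WBB k ->
  (-1) ^+ nneg k s
  = \prod_(i in ~: firstletters k) (-1) ^+ (s (i, false)).2 :> algC.
Proof.
move=> _; rewrite /nneg -sum1_card expr_sum big_mkcond [RHS]big_mkcond /=.
by apply: eq_bigr => i _; rewrite !inE; case: (_ < _)%N; case: (s _).2.
Qed.

Lemma nnegM k s t : s \in WBB k -> t \in WBB k ->
  (-1) ^+ nneg k (s * t) = (-1) ^+ nneg k s * (-1) ^+ nneg k t :> algC.
Proof.
move=> Ps Pt; have [Ws Wt] : s \in WB /\ t \in WB.
  by move: Ps Pt; rewrite !inE => /andP[-> _] /andP[-> _].
rewrite !nneg_sign ?groupM //.
rewrite [X in _ = _ * X](reindex_inj (@perm_inj _ (letterperm s))) /=.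
rewrite [X in _ = _ * X](eq_bigl (fun i => i \in ~: firstletters k)); last first.
  by move=> i; rewrite !finset.in_setC WBB_letter.
rewrite -big_split /=; apply: eq_bigr => i _.
rewrite letterpermE // permM [s (i, false)]surjective_pairing WB_snd //.
by rewrite -surjective_pairing signr_addb.
Qed.

(* The class function phi \x (psi * chi) on W(B_k) x W(B_(n - k)), where phi and
   psi are inflated along letterperm, and chi is 1 on permutations and -1 on a
   single sign change. *)
Fact boxchar_subproof k (phi : 'CF(Sym (firstletters k)))
    (psi : 'CF(Sym (~: firstletters k))) :
  is_class_fun <<WBB k>> [ffun s : {perm 'I_n * bool} =>
    (phi (restr_perm (firstletters k) (letterperm s))
     * (psi (restr_perm (~: firstletters k) (letterperm s)) * (-1) ^+ nneg k s))
    *+ (s \in WBB k)].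
Proof.
rewrite genGid; apply: intro_class_fun => [s t Ps Pt | s /negPf->//].
have [Ws Wt] : s \in WB /\ t \in WB.
  by move: Ps Pt; rewrite !inE => /andP[-> _] /andP[-> _].
have [s1 s2] := WBB_astabs Ps; have [t1 t2] := WBB_astabs Pt.
have inS (B : {set 'I_n}) u : restr_perm B u \in Sym B.
  by rewrite inE restr_perm_on.
rewrite groupJ // Ps /= (morphJ letterperm_morphism) //=.
rewrite (morphJ (restr_perm_morphism _)) //= (morphJ (restr_perm_morphism _)) //=.
rewrite !cfunJ ?inS //; congr (_ * (_ * _) *+ _).
rewrite conjgE nnegM ?groupM ?groupV // nnegM // mulrCA -nnegM ?groupV //.
by rewrite mulVg (nneg_sign (group1 _)) big1 ?mulr1 // => i _; rewrite perm1 expr0.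
Qed.
Definition boxchar k phi psi : 'CF(WBB k) := Cfun 0 (@boxchar_subproof k phi psi).

Definition bipartchar (xi eta : seq nat) : 'CF(WB) :=
  'Ind[WB] (boxchar (spechtchar (firstletters (sumn xi)) xi)
                    (spechtchar (~: firstletters (sumn xi)) eta)).

End SignedPermutations.

Local Open Scope classical_set_scope.
Local Open Scope nat_scope.

(* Positions are numbered from 1 in the mathematical notation (a_1, a_2, ...),
   whereas nth numbers them from 0. *)
Definition oddpos (s : seq nat) : seq nat :=
  [seq nth 0 s i | i <- iota 0 (size s) & ~~ odd i].
Definition evenpos (s : seq nat) : seq nat :=
  [seq nth 0 s i | i <- iota 0 (size s) & odd i].

Definition alternate (t b : seq nat) : seq nat :=
  mkseq (fun i => nth 0 (if odd i then b else t) i./2) (size t + size b).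

Definition symb (n : nat) : set (seq nat) :=
  [set L | [/\ odd (size L), sorted ltn (oddpos L), sorted ltn (evenpos L),
               sumn L = n + (size L)./2 ^ 2 & count_mem 0 L <= 1]].

Definition simple (L : seq nat) : pred nat := fun a => count_mem a L == 1.

(* The entries of L that appear exactly once, those in odd (even) position in L
   being placed, in order, in the odd (even) positions: the repeated entries are
   deleted separately in each of the two rows of the symbol. The result is the
   subsequence of simple entries of L, except when some simple entry lies between
   the two occurrences of an odd number of repeated entries: mere deletion would
   then move it from an odd to an even position or conversely, and the sequence
   of ranks would not be the element [bar L] of A_p. Thus (1, 0, 2, 1, 3) gives
   (2, 0, 3) and not (0, 2, 3). *)
Definition reduced (L : seq nat) : seq nat :=
  alternate [seq a <- oddpos L | simple L a] [seq a <- evenpos L | simple L a].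

Definition psymb (L : seq nat) : nat := (size (reduced L))./2.

Definition Ssymb (L : seq nat) : seq nat :=
  [seq j <- iota 1 (psymb L).*2 | nth 0 (reduced L) j.-1 > nth 0 (reduced L) j].

(* An element of A_p is a sequence b; the associated splitting (T, B) is
   (oddpos b, evenpos b). *)
Definition Aseq (p : nat) : set (seq nat) :=
  [set b | [/\ perm_eq b (iota 0 p.*2.+1), sorted ltn (oddpos b)
             & sorted ltn (evenpos b)]].

(* bump i (bump i _) is the order preserving bijection from N to N - {i, i + 1}.
   Here Y is a subset of Aseq p, and Iop p i Y one of Aseq p.+1. *)
Definition Iop (p i : nat) (Y : set (seq nat)) : set (seq nat) :=
  [set b | Aseq p.+1 b /\ exists2 y, Y y & exists t u,
     [/\ (t, u) = (i, i.+1) \/ (t, u) = (i.+1, i),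
         perm_eq (oddpos b) (t :: [seq bump i (bump i k) | k <- oddpos y])
       & perm_eq (evenpos b) (u :: [seq bump i (bump i k) | k <- evenpos y])]].

Fixpoint Bcoll (p : nat) : set (set (seq nat)) :=
  if p is q.+1 then
    [set [set iota 0 p.*2.+1]]
    `|` [set Z | exists i Y, [/\ i < p.*2, Bcoll q Y & Z = Iop q i Y]]
  else [set Aseq 0].

Fixpoint Ccoll (p : nat) : set (set (seq nat)) :=
  if p is q.+1 then
    [set Z | exists i Y, [/\ i < p.*2, Ccoll q Y & Z = Iop q i Y]]
  else [set Aseq 0].

(* The sequence in A_p such that k is in odd position iff z_k is in odd position
   in L, where z_0 < z_1 < ... are the simple entries of L. *)
Definition bar (L : seq nat) : seq nat :=
  [seq index a (sort leq (reduced L)) | a <- reduced L].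

(* From the increasing sequence a_1 < a_3 < ..., or a_2 < a_4 < ..., to the
   partition, with parts in decreasing order (possibly ending with zeros). *)
Definition partof (s : seq nat) : seq nat :=
  rev (mkseq (fun i => nth 0 s i - i) (size s)).

Definition Erep (n : nat) (L : seq nat) : 'CF(WB n) :=
  bipartchar n (partof (oddpos L)) (partof (evenpos L)).

Definition is_family (n : nat) (c : set 'CF(WB n)) : Prop :=
  exists2 L0, symb n L0
    & c = [set Erep n L | L in [set L | symb n L /\ perm_eq L L0]].

Definition symb_of (n : nat) (c : set 'CF(WB n)) : set (seq nat) :=
  [set L | symb n L /\ c (Erep n L)].

(* psymb is constant on symb_of c, so that any element of it may be used. *)
Definition pfam (n : nat) (c : set 'CF(WB n)) : nat :=
  psymb (xget [::] (symb_of c)).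

Definition sumrep (n : nat) (c : set 'CF(WB n)) (Y : set (seq nat)) : 'CF(WB n) :=
  (\sum_(L \in [set L | symb_of c L /\ Y (bar L)]) Erep n L)%R.

Definition newreps (n : nat) (c : set 'CF(WB n)) : set 'CF(WB n) :=
  [set sumrep c Y | Y in Bcoll (pfam c)].

Definition Con (n : nat) (c : set 'CF(WB n)) : set 'CF(WB n) :=
  [set sumrep c Y | Y in Ccoll (pfam c)].

(* [br] is a bijection E |-> [E] from c to the new representations such that E
   appears in [E]. *)
Definition is_bracket (n : nat) (c : set 'CF(WB n))
    (br : 'CF(WB n) -> 'CF(WB n)) : Prop :=
  set_bij c (newreps c) br /\ (forall E, c E -> (0 < '[br E, E])%R).

Definition symb_as (n : nat) (c : set 'CF(WB n)) : set (seq nat) :=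
  [set L | symb_of c L /\ size (Ssymb L) = pfam c].

Definition fam_as (n : nat) (c : set 'CF(WB n))
    (br : 'CF(WB n) -> 'CF(WB n)) : set 'CF(WB n) :=
  [set E | c E /\ Con c (br E)].

(* Main.v *)
Require Import Defs.
From mathcomp Require Import all_boot all_order all_algebra.
From mathcomp Require Import all_fingroup all_field all_character.
From mathcomp Require Import zify ring.
From mathcomp Require Import boolp classical_sets functions fsbigop.

(* Read an element of A_p as a word of length 2p+1, [true] at k meaning that k is
   in an odd position, and as a walk going up at [true] and down at [false], from
   height 0 to height 1. The i-th even entry b gives no descent exactly when
   t_i < b < t_(i+1), that is, when b is a step of the walk from 1 down to 0; hence
   |S| = p if and only if there is no such step. Inserting a pair i, i+1 never
   removes such a step, and the word of (0, 1, ..., 2p) has one as soon as p > 0: thus a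
   member of B_p containing an element with |S| = p lies in C_p. Conversely a
   member of C_p consists of the words compatible with a noncrossing matching of
   2p points of {0, ..., 2p} whose only unmatched point is not below an arc; among
   them, the word with arcs (false, true) before that point and (true, false) after
   it has |S| = p and determines the matching. So the elements with |S| = p are
   mapped injectively to C_p by the bracket, and C_p embeds into them: the bracket
   is onto C_p by finiteness.

   The condition that E appears in [E] has to be turned into membership of symbols,
   for which only the orthogonality of the E_Lambda is needed (they are nonzero
   because the bracket exists). For symmetric groups it follows from the dominance
   order: if Ind 1 from the row stabilizer of la and Ind sgn from the column
   stabilizer of mu are not orthogonal, Mackey's formula gives a tableau whose rows
   meet the columns of mu at most once. For the hyperoctahedral group, Mackey's
   formula and the action of sign changes reduce to the symmetric groups. *)

Set Implicit Arguments.
Unset Strict Implicit.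
Unset Printing Implicit Defensive.

(** * Characters of symmetric groups *)

Section SymmetricGroupCharacters.

Import Order.TTheory GRing.Theory Num.Theory GroupScope.
Local Open Scope ring_scope.

(** Frobenius reciprocity and the formula for induced class functions make the product a multiple of
    the sum of these inner sums over g. This is Mackey's criterion without double cosets: [psi]
    vanishes off [K], so each inner sum only sees the part of [H] that g conjugates into [K]. *)
Lemma cfdot_Ind_eq0 (gT : finGroupType) (G H K : {group gT})
    (phi : 'CF(H)) (psi : 'CF(K)) : H \subset G -> K \subset G ->
  (forall g, g \in G -> \sum_(x in H) phi x * (psi (x ^ g)%g)^* = 0) ->
  '['Ind[G] phi, 'Ind[G] psi] = 0.
Proof.
move=> sHG sKG h; rewrite -Frobenius_reciprocity cfdotE.
rewrite (eq_bigr (fun x => (#|K|%:R^-1)^* *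
   \sum_(g in G) phi x * (psi (x ^ g)%g)^*)); last first.
  move=> x Hx; rewrite cfResE // cfIndE // rmorphM /= rmorph_sum /=.
  by rewrite mulrCA mulr_sumr.
by rewrite -mulr_sumr exchange_big /= big1 ?mulr0 // => g Gg; rewrite h.
Qed.

(** Translation by [t] permutes [H] and negates the sum, which is therefore 0 in characteristic
    0. *)
Lemma sum_flip_eq0 (gT : finGroupType) (H : {group gT}) (F : gT -> algC) (t : gT) :
  t \in H -> {in H, forall x, F (t * x)%g = - F x} -> \sum_(x in H) F x = 0.
Proof.
move=> Ht h; set S := (LHS); suff : S = - S.
  by move/eqP; rewrite -addr_eq0 -mulr2n mulrn_eq0 /= => /eqP.
rewrite {1}/S (reindex_inj (mulgI t)) /= -sumrN.
rewrite (eq_bigl (mem H)) => [|x]; last by rewrite groupMl.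
exact: eq_bigr.
Qed.

Variable n : nat.
Implicit Types (A : {set 'I_n}) (la mu : seq nat).

Lemma cfsgn_char (G : {group 'S_n}) : cfsgn G \is a character.
Proof.
have repr : mx_repr G (fun s : 'S_n => ((-1) ^+ (s : bool))%:M : 'M[algC]_1).
  split=> [|s t _ _ /=]; first by rewrite odd_perm1.
  by rewrite odd_permM signr_addb scalar_mxM.
suff -> : cfsgn G = cfRepr (MxRepresentation repr) by apply: cfRepr_char.
by apply/cfunP=> s; rewrite !cfunE /= mxtrace_scalar mulr1n.
Qed.

Lemma mem_fiberstab_tperm A (f : 'I_n -> nat) i j :
  i \in A -> j \in A -> f i = f j -> tperm i j \in fiberstab A f.
Proof.
move=> Ai Aj fij; rewrite !inE; apply/andP; split.
  by apply/fintype.subsetP=> k; rewrite inE; case: tpermP => [->|->|]; rewrite ?eqxx.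
by apply/forallP=> k; case: tpermP => [->|->|]; rewrite ?fij ?eqxx.
Qed.

Lemma fiberstab_sub A (f : 'I_n -> nat) : fiberstab A f \subset Sym A.
Proof. by apply/fintype.subsetP=> s; rewrite inE => /andP[]. Qed.

(** If no such g exists, then for each g two letters i, j of [A] share a row for [f] while their
    images under g share a column for [h]. Translating by the transposition of i and j changes only
    the sign, so every Mackey term vanishes. *)
Lemma Ind_fiberstab_inj A (f h : 'I_n -> nat) :
  '['Ind[Sym A] (1 : 'CF(fiberstab_group A f)),
    'Ind[Sym A] (cfsgn (fiberstab_group A h))] != 0 ->
  exists2 g, g \in Sym A & {in A &, injective (fun i => (f i, h (g i)))}.
Proof.
move=> nz; apply: contrapT => no; case/eqP: nz.
apply: cfdot_Ind_eq0 => [||g Gg]; try exact: fiberstab_sub.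
have [i [j [Ai Aj ij fij hij]]] : exists i j,
    [/\ i \in A, j \in A, i != j, f i = f j & h (g i) = h (g j)].
  apply: contrapT => no'; apply: no; exists g => // i j Ai Aj [fij hij].
  by apply/eqP; apply: contrapT => /negP ij; apply: no'; exists i, j; split.
have Ag k : k \in A -> g k \in A.
  by move=> Ak; move: Gg; rewrite inE => /perm_closed->.
have Rt : tperm i j \in fiberstab_group A f by apply: mem_fiberstab_tperm.
apply: (sum_flip_eq0 Rt) => s Rs.
rewrite !cfun1E groupMl // Rs conjMg tpermJ !cfunE /= groupMl; last first.
  by apply: mem_fiberstab_tperm; rewrite ?Ag.
rewrite odd_permM odd_tperm (inj_eq perm_inj) ij signr_addb /= expr1 mulN1r.
by rewrite mulNrn rmorphN /= mulrN.
Qed.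

End SymmetricGroupCharacters.

(** * Tableaux and the dominance order *)

Section Tableaux.

Lemma reshape_index_cons a sh m :
  reshape_index (a :: sh) m = if m < a then 0 else (reshape_index sh (m - a)).+1.
Proof.
rewrite /reshape_index /= subn_eq0; case: ltnP => // am.
by rewrite subSn.
Qed.

Lemma reshape_offset_cons a sh m :
  reshape_offset (a :: sh) m = if m < a then m else reshape_offset sh (m - a).
Proof.
rewrite /reshape_offset reshape_index_cons; case: ltnP => am /=; first by rewrite subn0.
by rewrite subnDA.
Qed.

Lemma count_iota_add (P : pred nat) a s :
  count P (iota 0 (a + s)) =
  count P (iota 0 a) + count (fun m => P (a + m)) (iota 0 s).
Proof. by rewrite iotaD count_cat add0n -[X in iota X s]addn0 iotaDl count_map. Qed.

Lemma count_reshape_index la j :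
  count (fun m => reshape_index la m == j) (iota 0 (sumn la)) = nth 0 la j.
Proof.
elim: la j => [|a la IH] j; first by rewrite nth_nil.
rewrite /= count_iota_add.
rewrite (@eq_in_count _ _ (fun=> 0 == j)); last first.
  by move=> m; rewrite mem_iota reshape_index_cons => /= ->.
under [X in _ + X]eq_count => m do
  rewrite reshape_index_cons ltnNge leq_addr /= addKn.
case: j => [|j] /=; last first.
  by rewrite (@eq_count _ _ pred0) // count_pred0 -IH; under eq_count do rewrite eqSS.
by rewrite count_predT size_iota (@eq_count _ _ pred0) ?count_pred0 ?addn0.
Qed.

(** A row of length a has min(a, k) cells in the first k columns. The right-hand side is thus a
    partial sum of the conjugate partition, the form in which dominance is used below. *)
Lemma count_reshape_offset la k :
  count (fun m => reshape_offset la m < k) (iota 0 (sumn la)) =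
  \sum_(a <- la) minn a k.
Proof.
elim: la => [|a la IH]; first by rewrite big_nil.
rewrite /= count_iota_add big_cons -IH; congr (_ + _); last first.
  by apply: eq_count => m; rewrite reshape_offset_cons [a + m < a]ltnNge leq_addr /= addKn.
rewrite (@eq_in_count _ _ (fun m => m < k)); last first.
  by move=> m; rewrite mem_iota reshape_offset_cons => /= ->.
rewrite -size_filter; elim: a => [|a IHa]; first by rewrite min0n.
rewrite -addn1 iotaD filter_cat size_cat IHa /= add0n.
by case: (ltnP a k) => ak /=; lia.
Qed.

Lemma map_index_uniq (T : eqType) (s : seq T) :
  uniq s -> [seq index x s | x <- s] = iota 0 (size s).
Proof.
case: s => // x0 s us; apply: (@eq_from_nth _ 0); rewrite size_map ?size_iota // => i ilt.
by rewrite (nth_map x0) // index_uniq // nth_iota.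
Qed.

Lemma card_enum_index (T : finType) (A : {set T}) (P : pred nat) :
  #|[set x in A | P (index x (enum A))]%SET| = count P (iota 0 #|A|).
Proof.
rewrite [in RHS]cardE -map_index_uniq ?enum_uniq // count_map -size_filter cardE.
apply: perm_size; apply: uniq_perm => [||x]; [exact: enum_uniq | exact/filter_uniq/enum_uniq |].
by rewrite mem_filter !mem_enum inE andbC.
Qed.

(** Count the letters that g sends into the first k columns of [mu]. Those in one row of [la] go to
    distinct columns, so a row of length a contains at most min(a, k) of them. *)
Lemma dominance n (A : {set 'I_n}) (la mu : seq nat) (g : 'S_n) k :
  g \in Sym A -> sumn la = #|A| -> sumn mu = #|A| ->
  {in A &, injective (fun i => (tabrow A la i, tabcol A mu (g i)))} ->
  \sum_(a <- mu) minn a k <= \sum_(a <- la) minn a k.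
Proof.
move=> Ag sla smu ginj.
pose B := [set i in A | tabcol A mu (g i) < k]%SET.
have gA i : (g i \in A) = (i \in A).
  by apply: perm_closed; move: Ag; rewrite inE.
have cB : #|B| = \sum_(a <- mu) minn a k.
  rewrite -count_reshape_offset smu -(card_enum_index _ (fun m => _ < k)).
  rewrite -(card_imset _ (@perm_inj _ g)); apply: eq_card => i; rewrite !inE.
  apply/imsetP/andP => [[j]|[Ai ik]].
    by rewrite inE => /andP[Aj jk] ->; rewrite gA.
  exists (g^-1 i)%g; last by rewrite permKV.
  by rewrite inE -gA permKV Ai.
have row_lt i : i \in A -> tabrow A la i < size la.
  by move=> Ai; apply: reshape_indexP; rewrite sla cardE index_mem mem_enum.
rewrite -cB -sum1_card.
apply: (@leq_trans (\sum_(i in B) \sum_(j < size la) (tabrow A la i == j))).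
  apply: leq_sum => i; rewrite inE => /andP[/row_lt Ai _].
  by rewrite (bigD1 (Ordinal Ai)) //= eqxx.
rewrite exchange_big (big_nth 0) big_mkord; apply: leq_sum => j _ /=.
rewrite -big_mkcondr sum1_card leq_min; set Bj := (X in #|X|).
have memBj i :
    (i \in Bj) = [&& i \in A, tabcol A mu (g i) < k & tabrow A la i == j].
  by rewrite unfold_in /B inE -andbA.
apply/andP; split.
  rewrite -count_reshape_index sla -(card_enum_index _ (fun m => _ == _)).
  apply/subset_leq_card/fintype.subsetP => i.
  by rewrite memBj inE => /and3P[-> _].
rewrite cardE -(size_map (fun i => tabcol A mu (g i))).
rewrite -[leqRHS](size_iota 0); apply: uniq_leq_size => [|x].
  rewrite map_inj_in_uniq ?enum_uniq // => i1 i2.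
  rewrite !mem_enum !memBj => /and3P[A1 _ /eqP r1].
  move=> /and3P[A2 _ /eqP r2] e; apply: ginj => //.
  by rewrite r1 r2 e.
case/mapP => i; rewrite mem_enum memBj => /and3P[_ ik _] ->.
by rewrite mem_iota.
Qed.

Lemma nth_gt_count (s : seq nat) k j :
  sorted geq s -> (k < nth 0 s j) = (j < count (ltn k) s).
Proof.
elim: s j => [|a s IH] j /=; first by rewrite nth_nil.
move=> pas; have ss := path_sorted pas.
have c0 : a <= k -> count (ltn k) s = 0.
  move=> ak; apply/eqP; rewrite -leqn0 leqNgt -has_count; apply/hasPn => b.
  move: pas; rewrite (path_sortedE (rev_trans leq_trans)) => /andP[/allP h _].
  by move=> /h /= ba; rewrite -leqNgt (leq_trans ba).
case: j => [|j] /=; first by case: (ltnP k a) => //= /c0->.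
by rewrite (IH _ ss); case: (ltnP k a) => //= /c0->.
Qed.

(** Passing from k to k+1 adds the number of parts exceeding k, and these numbers determine a
    decreasing sequence up to trailing zeros, whence the comparison through [nth 0]. *)
Lemma eq_part_sum_minn (la mu : seq nat) : sorted geq la -> sorted geq mu ->
  (forall k, \sum_(a <- mu) minn a k = \sum_(a <- la) minn a k) ->
  nth 0 la =1 nth 0 mu.
Proof.
move=> sla smu h j.
have hc k s : \sum_(a <- s) minn a k.+1 = \sum_(a <- s) minn a k + count (ltn k) s.
  elim: s => [|a s IH]; first by rewrite !big_nil.
  by rewrite !big_cons IH /=; case: (ltnP k a) => ak; lia.
have e k : count (ltn k) la = count (ltn k) mu.
  by apply/eqP; rewrite -(eqn_add2l (\sum_(a <- la) minn a k)) -hc -!h -hc.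
apply/eqP; rewrite eqn_leq; apply/andP; split; rewrite leqNgt.
  by rewrite nth_gt_count // e -nth_gt_count // ltnn.
by rewrite nth_gt_count // -e -nth_gt_count // ltnn.
Qed.

(** If both characters are the same irreducible, it is common to the row induction of either
    partition and the column induction of the other, so each partition dominates the other. If a
    pick fails, the character is 0. *)
Lemma spechtchar_ortho n (A : {set 'I_n}) (la mu : seq nat) :
  sorted geq la -> sorted geq mu -> sumn la = #|A| -> sumn mu = #|A| ->
  ~ (nth 0 la =1 nth 0 mu) ->
  '[spechtchar A la, spechtchar A mu]%R = 0%R.
Proof.
move=> ola omu sla smu ne; rewrite /spechtchar.
case: pickP => [i /andP[i1 i2]|_]; last by rewrite cfdot0l.
case: pickP => [j /andP[j1 j2]|_]; last by rewrite cfdot0r.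
apply/eqP; rewrite cfdot_irr; case: (i =P j) => [ij|_]; last by rewrite eqxx.
case: ne; subst j; apply: eq_part_sum_minn => // k; apply/eqP.
have dom l m : sumn l = #|A| -> sumn m = #|A| ->
  i \in irr_constt ('Ind[Sym A] (1%R : 'CF(fiberstab_group A (tabrow A l))))%R ->
  i \in irr_constt ('Ind[Sym A] (cfsgn (fiberstab_group A (tabcol A m))))%R ->
  \sum_(a <- m) minn a k <= \sum_(a <- l) minn a k.
  move=> sl sm h1 h2.
  have [|g Ag ginj] := @Ind_fiberstab_inj _ A (tabrow A l) (tabcol A m); last first.
    exact: dominance Ag sl sm ginj.
  apply/eqP => e0.
  have := @constt_ortho_char _ _ _ _ i i _ _ h1 h2 e0.
  rewrite !cfInd_char ?cfun1_char ?cfsgn_char // cfnorm_irr.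
  by move=> /(_ isT isT) /eqP; rewrite GRing.oner_eq0.
by rewrite eqn_leq !dom.
Qed.

End Tableaux.

(** * Characters of signed permutation groups *)

Section SignedPermutationCharacters.

Import Order.TTheory GRing.Theory Num.Theory GroupScope.
Local Open Scope ring_scope.

Variable n : nat.
Implicit Types (k : nat) (i : 'I_n) (s g : {perm 'I_n * bool}) (u : 'S_n).

Definition flip i : {perm 'I_n * bool} := tperm (i, false) (i, true).

Fact signedperm_subproof u : injective (fun x : 'I_n * bool => (u x.1, x.2)).
Proof. by move=> [i b] [j c] [/perm_inj-> ->]. Qed.
Definition signedperm u : {perm 'I_n * bool} := perm (@signedperm_subproof u).

Lemma mem_WB s : (forall x, s (negletter x) = negletter (s x)) -> s \in WB n.
Proof.
move=> h; apply/cent1P/permP => x; by rewrite !permM !permE /= h.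
Qed.

Lemma mem_WBB k s : s \in WB n ->
  (forall i, (letterperm s i \in firstletters n k) = (i \in firstletters n k)) ->
  s \in WBB n k.
Proof.
move=> Ws h; rewrite inE Ws; apply/astabsP => -[i b].
by have := h i; rewrite !inE /= /aperm WB_fst // -letterpermE.
Qed.

Lemma WBB_sub k : WBB n k \subset WB n.
Proof. exact: subsetIl. Qed.

Lemma flipE i j b : flip i (j, b) = (j, (j == i) (+) b).
Proof.
rewrite /flip; case: tpermP => [[-> ->]|[-> ->]|ne1 ne2]; rewrite ?eqxx //.
by case: eqP ne1 ne2 => // -> ; case: b.
Qed.

Lemma flip_WB i : flip i \in WB n.
Proof. by apply: mem_WB => -[j b]; rewrite /negletter !flipE /= addbN. Qed.

Lemma letterperm_flip i : letterperm (flip i) = 1%g.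
Proof. by apply/permP=> j; rewrite letterpermE ?flip_WB // flipE perm1. Qed.

Lemma flip_WBB k i : flip i \in WBB n k.
Proof. by apply: mem_WBB => [|j]; rewrite ?flip_WB // letterperm_flip perm1. Qed.

Lemma flip_conj s i : s \in WB n -> (flip i ^ s)%g = flip (letterperm s i).
Proof.
move=> Ws; rewrite /flip tpermJ letterpermE //.
rewrite -[(i, true)]/(negletter (i, false)) WB_neg //.
by case: (s (i, false)) => j [] //=; rewrite tpermC.
Qed.

Lemma nneg_flip k i :
  (-1) ^+ nneg k (flip i) = (-1) ^+ (i \notin firstletters n k) :> algC.
Proof.
rewrite (nneg_sign (flip_WBB k i)).
have [Fi|Fi] := boolP (i \in firstletters n k).
  rewrite big1 // => j; rewrite finset.in_setC flipE /=; case: eqP => // ->.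
  by rewrite Fi.
rewrite (bigD1 i) ?finset.in_setC //= flipE eqxx /= big1 ?mulr1 // => j /andP[_ ji].
by rewrite flipE (negPf ji).
Qed.

(** Sign changes act by scalars, 1 on the first k letters and -1 on the others. This linear
    character of the group of sign changes is what separates different k. *)
Lemma boxcharM_flip k phi psi i s :
  @boxchar n k phi psi (flip i * s)%g =
  (-1) ^+ (i \notin firstletters n k) * boxchar phi psi s.
Proof.
rewrite !cfunE groupMl ?flip_WBB //; have [Ps|_] := boolP (s \in WBB n k).
  rewrite nnegM ?flip_WBB // nneg_flip letterpermM ?flip_WB //.
    by rewrite letterperm_flip mul1g !mulr1n; set x := (-1) ^+ _; ring.
  exact: fintype.subsetP (WBB_sub k) _ Ps.
by rewrite !mulr0n mulr0.
Qed.

Lemma signedperm_WB u : signedperm u \in WB n.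
Proof. by apply: mem_WB => x; rewrite !permE. Qed.

Lemma signedpermK u : letterperm (signedperm u) = u.
Proof. by apply/permP => i; rewrite letterpermE ?signedperm_WB // permE. Qed.

Lemma card_firstletters k : (k <= n)%N -> #|firstletters n k| = k.
Proof.
move=> kn; rewrite -sum1_card (eq_bigl (fun i : 'I_n => (i < k)%N)).
  by rewrite -(big_ord_widen n (fun=> 1%N)) // sum1_card card_ord.
by move=> i; rewrite inE.
Qed.

Lemma restr_perm_id (B : {set 'I_n}) u : u \in Sym B -> restr_perm B u = u.
Proof.
rewrite inE => Bu; have Nu : u \in 'N(B | 'P)%g.
  by apply/astabsP => i; exact: perm_closed.
apply/permP => i; have [Bi|Bi] := boolP (i \in B); first by rewrite restr_permE.
by rewrite (out_perm (restr_perm_on _ _)) // (out_perm Bu).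
Qed.

Lemma restr_perm_compl (B : {set 'I_n}) u :
  u \in Sym B -> restr_perm (~: B) u = 1%g.
Proof.
rewrite inE => Bu; have Nu : u \in 'N(~: B | 'P)%g.
  by apply/astabsP => i; rewrite !inE; congr (~~ _); exact: perm_closed.
apply/permP => i; rewrite perm1; have [Bi|Bi] := boolP (i \in ~: B).
  by rewrite restr_permE // (out_perm Bu) //; rewrite inE in Bi.
by rewrite (out_perm (restr_perm_on _ _)).
Qed.

(* Averaging over right translations by signed permutations of B. *)
Lemma sum_restr_perm_eq0 k (B D : {set 'I_n}) (f h : 'S_n -> algC) :
  B = firstletters n k \/ B = ~: firstletters n k -> D = ~: B ->
  \sum_(u in Sym B) f u = 0 ->
  \sum_(s in WBB n k)
    f (restr_perm B (letterperm s)) * h (restr_perm D (letterperm s)) = 0.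
Proof.
move=> Bk -> f0; set S := LHS.
(* Add up #|Sym B| copies of the sum, the copy of index u being reindexed by translation by u. *)
suff : \sum_(u in Sym B) S = 0.
  move/eqP; rewrite sumr_const mulrn_eq0 -leqn0 leqNgt.
  by rewrite (cardG_gt0 (Sym_group B)) => /eqP.
have NB s : s \in WBB n k ->
    letterperm s \in 'N(B | 'P)%g /\ letterperm s \in 'N(~: B | 'P)%g.
  by case: Bk => -> /WBB_astabs[]; rewrite ?finset.setCK.
have NC u : u \in Sym B -> signedperm u \in WBB n k.
  rewrite inE => Bu; apply: mem_WBB => [|i]; first exact: signedperm_WB.
  rewrite signedpermK; have := perm_closed i Bu.
  by case: Bk => ->; rewrite // !finset.in_setC => /negb_inj.
transitivity (\sum_(u in Sym B) \sum_(s in WBB n k)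
    f (restr_perm B (letterperm s) * u)%g * h (restr_perm (~: B) (letterperm s))).
  apply: eq_bigr => u Bu; rewrite /S (reindex_inj (mulIg (signedperm u))) /=.
  rewrite (eq_bigl (mem (WBB n k))) => [|s]; last by rewrite groupMr ?NC.
  apply: eq_bigr => s Ps; have [N1 N2] := NB _ Ps.
  have [M1 M2] := NB _ (NC _ Bu); rewrite signedpermK in M1 M2.
  rewrite letterpermM ?signedperm_WB ?(fintype.subsetP (WBB_sub k)) //.
  rewrite signedpermK !morphM //=.
  by rewrite (restr_perm_id Bu) (restr_perm_compl Bu) mulg1.
rewrite exchange_big big1 //= => s Ps; rewrite -mulr_suml.
set v := restr_perm B _.
have -> : \sum_(u in Sym B) f (v * u)%g = \sum_(u in Sym B) f u.
  rewrite [RHS](reindex_inj (mulgI v)) /=; apply: eq_bigl => u.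
  by rewrite groupMl // inE restr_perm_on.
by rewrite f0 mul0r.
Qed.

Lemma boxchar_ortho k (phi phi' : 'CF(Sym (firstletters n k)))
    (psi psi' : 'CF(Sym (~: firstletters n k))) :
  '[phi, phi'] = 0 \/ '[psi, psi'] = 0 ->
  \sum_(s in WBB n k) boxchar phi psi s * (boxchar phi' psi' s)^* = 0.
Proof.
have sum0 (A : {set 'I_n}) (f f' : 'CF(Sym A)) : '[f, f'] = 0 ->
    \sum_(u in Sym A) f u * (f' u)^* = 0.
  move/eqP; rewrite cfdotE mulf_eq0 invr_eq0 pnatr_eq0 -leqn0 leqNgt.
  by rewrite (cardG_gt0 (Sym_group A)) => /eqP.
move=> h; transitivity (\sum_(s in WBB n k)
  (fun u => phi u * (phi' u)^*) (restr_perm (firstletters n k) (letterperm s)) *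
  (fun u => psi u * (psi' u)^*) (restr_perm (~: firstletters n k) (letterperm s))).
  apply: eq_bigr => s Ps; rewrite !cfunE Ps !mulr1n !rmorphM /= rmorph_sign.
  by rewrite mulrACA; congr (_ * _); rewrite mulrACA -expr2 sqrr_sign mulr1.
case: h => /sum0 h0.
  exact: (sum_restr_perm_eq0 (fun u => psi u * (psi' u)^*) (or_introl erefl) erefl h0).
under eq_bigr do rewrite mulrC.
apply: (sum_restr_perm_eq0 (fun u => phi u * (phi' u)^*) (or_intror erefl) _ h0).
by rewrite finset.setCK.
Qed.

(** Some letter i lies in one block while its image under g lies in the other kind of block. The
    sign change of i then acts by opposite scalars on the two factors. *)
Lemma sum_boxchar_flip_eq0 k k' phi psi phi' psi' g : g \in WB n ->
  ~ (forall i, (letterperm g i \in firstletters n k') = (i \in firstletters n k)) ->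
  \sum_(s in WBB n k)
    @boxchar n k phi psi s * (@boxchar n k' phi' psi' (s ^ g)%g)^* = 0.
Proof.
move=> Wg no; have [i ig] : exists i,
    (letterperm g i \in firstletters n k') != (i \in firstletters n k).
  apply: contrapT => no'; apply: no => i; apply/eqP.
  by apply: contrapT => /negP h; apply: no'; exists i.
apply: (sum_flip_eq0 (flip_WBB k i)) => s Ps.
rewrite conjMg flip_conj // !boxcharM_flip rmorphM /= rmorph_sign.
rewrite mulrACA -signr_addb -[RHS]mulN1r; congr (_ * _).
by move: ig; do 2!case: (_ \in _).
Qed.

Lemma Ind_boxchar_ortho_size k k' phi psi phi' psi' : (k <= n)%N -> (k' <= n)%N ->
  k != k' ->
  '['Ind[WB n] (@boxchar n k phi psi), 'Ind[WB n] (@boxchar n k' phi' psi')] = 0.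
Proof.
move=> kn kn' kk; apply: cfdot_Ind_eq0 => [||g Wg]; try exact: WBB_sub.
apply: sum_boxchar_flip_eq0 => // h; case/eqP: kk.
(* A g matching the two blocks would put sets of sizes k and k' in bijection. *)
rewrite -(card_firstletters kn) -(card_firstletters kn').
rewrite -[RHS](card_imset _ (@perm_inj _ (letterperm g)^-1)).
apply: eq_card => i; rewrite -h; apply/idP/imsetP => [gi|[j jF ->]].
  by exists (letterperm g i); rewrite // permK.
by rewrite permKV.
Qed.

(** Only the g preserving the block contribute. They lie in [WBB n k], so conjugation by g does not
    affect the class function, and the sum factors over the two symmetric groups. *)
Lemma Ind_boxchar_ortho k phi psi phi' psi' :
  '[phi, phi'] = 0 \/ '[psi, psi'] = 0 ->
  '['Ind[WB n] (@boxchar n k phi psi), 'Ind[WB n] (@boxchar n k phi' psi')] = 0.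
Proof.
move=> h; apply: cfdot_Ind_eq0 => [||g Wg]; try exact: WBB_sub.
have [gk|no] := pselect (forall i,
    (letterperm g i \in firstletters n k) = (i \in firstletters n k)).
  rewrite -[RHS](boxchar_ortho h); apply: eq_bigr => s Ps.
  by rewrite cfunJ // mem_WBB.
exact: sum_boxchar_flip_eq0.
Qed.

Lemma bipartchar_ortho xi eta xi' eta' :
  (sumn xi + sumn eta = n)%N -> (sumn xi' + sumn eta' = n)%N ->
  sorted geq xi -> sorted geq eta -> sorted geq xi' -> sorted geq eta' ->
  ~ (nth 0%N xi =1 nth 0%N xi' /\ nth 0%N eta =1 nth 0%N eta') ->
  '[bipartchar n xi eta, bipartchar n xi' eta'] = 0.
Proof.
move=> s s' o1 o2 o1' o2' ne; rewrite /bipartchar.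
have kn : (sumn xi <= n)%N by rewrite -s leq_addr.
have kn' : (sumn xi' <= n)%N by rewrite -s' leq_addr.
have [e|] := eqVneq (sumn xi) (sumn xi'); last exact: Ind_boxchar_ortho_size.
rewrite -e; apply: Ind_boxchar_ortho.
have cC : #|~: firstletters n (sumn xi)| = sumn eta.
  by have := cardsC (firstletters n (sumn xi)); rewrite card_firstletters // card_ord; lia.
have [e1|ne1] := pselect (nth 0%N xi =1 nth 0%N xi').
  right; apply: spechtchar_ortho; rewrite ?cC //; first lia.
  by move=> e2; apply: ne.
by left; apply: spechtchar_ortho; rewrite ?card_firstletters.
Qed.

End SignedPermutationCharacters.

(** * Symbols and bipartitions *)

Section Rows.

Implicit Types s t b : seq nat.

(** Prepending an entry exchanges the two rows, which makes induction on sequences possible. *)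
Lemma oddpos_evenpos_cons a s :
  (oddpos (a :: s) = a :: evenpos s) * (evenpos (a :: s) = oddpos s).
Proof.
have e (P : pred nat) : [seq nth 0 (a :: s) i | i <- iota 1 (size s) & P i] =
    [seq nth 0 s i | i <- iota 0 (size s) & P i.+1].
  by rewrite -[1]/(1 + 0) iotaDl filter_map -map_comp.
rewrite /oddpos /evenpos /= !e; split; first by under eq_filter do rewrite negbK.
by [].
Qed.

Definition oddpos_cons a s := (oddpos_evenpos_cons a s).1.
Definition evenpos_cons a s := (oddpos_evenpos_cons a s).2.

Lemma alternate_cons a t b : alternate (a :: t) b = a :: alternate b t.
Proof.
rewrite /alternate /mkseq /= -[iota 1 _]/(iota (1 + 0) _) iotaDl -map_comp addnC.
congr cons; apply: eq_map => i /=; rewrite uphalf_half.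
by case: (odd i); rewrite ?add0n ?add1n.
Qed.

Lemma alternate_rows s : alternate (oddpos s) (evenpos s) = s.
Proof.
elim: s => // a s IH; rewrite oddpos_cons evenpos_cons alternate_cons.
by rewrite IH.
Qed.

Lemma rows_alternate t b : size b <= size t <= (size b).+1 ->
  (oddpos (alternate t b) = t) * (evenpos (alternate t b) = b).
Proof.
have [m] := ubnP (size t + size b); elim: m t b => // m IH [|a t] b.
  by rewrite leqn0 => _ /andP[/nilP->].
rewrite /= addSn !ltnS => st /andP[sb tb].
by rewrite alternate_cons oddpos_cons evenpos_cons !IH // ?tb // addnC.
Qed.

Lemma perm_rows s : perm_eq (oddpos s ++ evenpos s) s.
Proof.
elim: s => // a s IH; rewrite oddpos_cons evenpos_cons /= perm_cons.
by rewrite perm_catC.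
Qed.

Lemma size_rows s : (size (oddpos s) = uphalf (size s)) *
  (size (evenpos s) = (size s)./2).
Proof. by elim: s => // a s IH; rewrite oddpos_cons evenpos_cons /= !IH. Qed.

Lemma sorted_ltn_leq_nth s i : sorted ltn s -> i < size s -> i <= nth 0 s i.
Proof.
move=> /(sortedP 0) h; elim: i => // i IH il.
by apply: leq_ltn_trans (h _ il); apply/IH/ltnW.
Qed.

Lemma nth_partof s j : nth 0 (partof s) j =
  if j < size s then nth 0 s (size s - j.+1) - (size s - j.+1) else 0.
Proof.
rewrite /partof; case: ltnP => js; last by rewrite nth_default // size_rev size_mkseq.
by rewrite nth_rev size_mkseq // nth_mkseq //; lia.
Qed.

Lemma sorted_partof s : sorted ltn s -> sorted geq (partof s).
Proof.
move=> ss; rewrite /partof rev_sorted; apply/(sortedP 0) => i.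
rewrite size_mkseq => il; rewrite !nth_mkseq //; last exact: ltnW.
by move/(sortedP 0)/(_ _ il): ss; lia.
Qed.

Lemma sumn_partof s : sorted ltn s ->
  sumn (partof s) + \sum_(i < size s) i = sumn s.
Proof.
move=> ss; rewrite /partof sumn_rev !sumnE /mkseq big_map -[X in iota 0 X]subn0.
rewrite -/(index_iota 0 (size s)) big_mkord -big_split /=.
rewrite [RHS](big_nth 0) big_mkord; apply: eq_bigr => i _.
by rewrite subnK // sorted_ltn_leq_nth.
Qed.

(** The longer row has d additional zero parts, that is, it starts with 0, ..., d-1, and the other
    entries are those of [s] shifted by d. *)
Lemma eq_partof s s' d : sorted ltn s -> sorted ltn s' ->
  size s' = d + size s -> nth 0 (partof s) =1 nth 0 (partof s') ->
  s' = iota 0 d ++ [seq d + a | a <- s].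
Proof.
move=> ss ss' sd h; apply: (@eq_from_nth _ 0).
  by rewrite size_cat size_map size_iota.
move=> i il; rewrite nth_cat size_iota.
(* [partof] lists the row from its last entry, so entry i is read at this index. *)
have := h (size s' - i.+1); rewrite !nth_partof.
have -> : size s' - (size s' - i.+1).+1 = i by lia.
have := sorted_ltn_leq_nth ss' il.
case: (ltnP i d) => id.
  rewrite nth_iota // ifF; last by lia.
  by case: ifP => //; lia.
have ils : i - d < size s by lia.
have := sorted_ltn_leq_nth ss ils.
rewrite (nth_map 0) // [X in X = _]ifT; last by lia.
have -> : size s - (size s' - i.+1).+1 = i - d by lia.
by case: ifP => //; lia.
Qed.

End Rows.

Section Symbols.

Variable n : nat.
Implicit Types L : seq nat.

Lemma symb_rows L : symb n L ->
  [/\ size (oddpos L) = (size (evenpos L)).+1, sorted ltn (oddpos L),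
      sorted ltn (evenpos L), size (evenpos L) = (size L)./2
    & sumn (oddpos L) + sumn (evenpos L) = n + (size L)./2 ^ 2].
Proof.
case=> oL sO sE sL _; split=> //; last first.
- by rewrite -sL -sumn_cat; apply/perm_sumn/perm_rows.
- by rewrite size_rows.
by rewrite !size_rows uphalf_half oL.
Qed.

Lemma sum_ord_id m : (\sum_(i < m) i) * 2 = m * m.-1.
Proof.
elim: m => [|m IH]; first by rewrite big_ord0.
by rewrite big_ord_recr /= mulnDl {}IH -mulnDr mulnC; case: m => //= m; lia.
Qed.

(** With m the length of the even row, the subtracted staircases add up to m(m+1)/2 + m(m-1)/2 =
    m^2. *)
Lemma symb_sum_parts L : symb n L ->
  sumn (partof (oddpos L)) + sumn (partof (evenpos L)) = n.
Proof.
case/symb_rows => sz sO sE sE2 sm.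
have := sumn_partof sO; have := sumn_partof sE; rewrite sz.
have := sum_ord_id (size (evenpos L)); rewrite big_ord_recr /=.
move: sm; rewrite -sE2; nia.
Qed.

Lemma symb_parts_inj L L' : symb n L -> symb n L' ->
  nth 0 (partof (oddpos L)) =1 nth 0 (partof (oddpos L')) ->
  nth 0 (partof (evenpos L)) =1 nth 0 (partof (evenpos L')) -> L = L'.
Proof.
wlog le : L L' / size (evenpos L) <= size (evenpos L').
  move=> W sL sL' h1 h2; have [le|/ltnW le] := leqP (size (evenpos L)) (size (evenpos L')).
    exact: W.
  by apply/esym/W.
move=> sL sL' h1 h2.
have [z t b _ _] := symb_rows sL; have [z' t' b' _ _] := symb_rows sL'.
have e1 : size (oddpos L') = size (evenpos L') - size (evenpos L) + size (oddpos L) by lia.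
have e2 : size (evenpos L') = size (evenpos L') - size (evenpos L) + size (evenpos L) by lia.
have r1 := eq_partof t t' e1 h1; have r2 := eq_partof b b' e2 h2.
case: (size (evenpos L') - _) r1 r2 => [|d] r1 r2.
  rewrite -[L]alternate_rows -[L']alternate_rows r1 r2 /=.
  by rewrite !map_id_in.
(* A positive shift would put 0 in both rows of [L'], where it may occur only once. *)
case: sL' => _ _ _ _; rewrite -(seq.permP (perm_rows L')) r1 r2 /= count_cat /=.
by lia.
Qed.

Lemma Erep_ortho L L' : symb n L -> symb n L' -> L <> L' ->
  '[Erep n L, Erep n L']%R = 0%R.
Proof.
move=> sL sL' ne; have [_ t b _ _] := symb_rows sL; have [_ t' b' _ _] := symb_rows sL'.
apply: bipartchar_ortho; rewrite ?symb_sum_parts ?sorted_partof // => -[h1 h2].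
by apply: ne; apply: symb_parts_inj.
Qed.

End Symbols.

(** * Words and noncrossing matchings *)

Section Words.

Implicit Types (u v w : seq bool) (x y : bool) (a b i : nat).

(* The walk starting at height [a - b] has no step from 1 down to 0; [a] and [b]
   count the letters [true] and [false] already read. *)
Fixpoint nocross a b w : bool :=
  if w is x :: w' then
    if x then nocross a.+1 b w' else (a != b.+1) && nocross a b.+1 w'
  else true.

Lemma nocross_cat a b u v : nocross a b (u ++ v) =
  nocross a b u && nocross (a + count id u) (b + count negb u) v.
Proof.
elim: u a b => [|[] u IH] a b /=; rewrite ?addn0 // ?IH ?addSnnS ?add1n ?add0n //.
by rewrite andbA.
Qed.

Lemma nocrossSS a b w : nocross a.+1 b.+1 w = nocross a b w.
Proof. by elim: w a b => //= -[] w IH a b; rewrite ?eqSS IH. Qed.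

Definition ins i x w := take i w ++ [:: x, ~~ x & drop i w].

(** The inserted pair goes up once and down once, so the heights of the remaining steps do not
    change. *)
Lemma nocross_ins a b i x w : nocross a b (ins i x w) -> nocross a b w.
Proof.
rewrite -{2}(cat_take_drop i w) /ins !nocross_cat => /andP[-> /=].
by case: x => /=; rewrite nocrossSS => // /andP[].
Qed.

Lemma ins_cons i x y w : ins i.+1 x (y :: w) = y :: ins i x w.
Proof. by []. Qed.

Lemma ins_catl i x u v : i <= size u -> ins i x (u ++ v) = ins i x u ++ v.
Proof.
rewrite /ins take_cat drop_cat leq_eqVlt => /predU1P[->|->].
  by rewrite ltnn subnn take0 drop0 cats0 take_size drop_size -catA.
by rewrite -catA.
Qed.

Lemma ins_catr i x u v : size u <= i -> ins i x (u ++ v) = u ++ ins (i - size u) x v.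
Proof.
by move=> ui; rewrite /ins take_cat drop_cat ltnNge ui /= -catA.
Qed.

Lemma nth_ins i x w k : i <= size w -> nth false (ins i x w) k =
  if k < i then nth false w k else
  if k == i then x else if k == i.+1 then ~~ x else nth false w (k - 2).
Proof.
move=> iw; rewrite /ins nth_cat size_takel //; case: ltnP => ki; first exact: nth_take.
have [->|ki2] := eqVneq k i; first by rewrite subnn.
have [->|ki3] := eqVneq k i.+1; first by rewrite subSnn.
have -> : k - i = (k - i - 2).+2 by lia.
by rewrite /= nth_drop; congr nth; lia.
Qed.

(* Binary trees encode complete noncrossing matchings: [Node a b] has the arc
   from the first point to the point preceding the matching b. *)
Inductive tree := Leaf | Node of tree & tree.

Fixpoint nodes t := if t is Node a b then (nodes a + nodes b).+1 else 0.

(** The two ends of every arc carry opposite letters, in either order. *)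
Fixpoint fits t w : Prop :=
  if t is Node a b then
    exists x u v, [/\ fits a u, fits b v & w = x :: u ++ ~~ x :: v]
  else w = [::].

Fixpoint dyck x t :=
  if t is Node a b then x :: dyck x a ++ ~~ x :: dyck x b else [::].

(** Insertion of an arc joining two adjacent points at position i. After the opening point of the
    first arc, positions up to twice [nodes a] are still inside that arc; beyond them, the points of
    [a] and the closing point are skipped. *)
Fixpoint tins t i :=
  match t, i with
  | Leaf, _ => Node Leaf Leaf
  | _, 0 => Node Leaf t
  | Node a b, i'.+1 => if i' <= (nodes a).*2 then Node (tins a i') b
                       else Node a (tins b (i' - (nodes a).*2.+1))
  end.

Lemma count_fits t w : fits t w -> count id w = nodes t /\ count negb w = nodes t.
Proof.
elim: t w => [|a IHa b IHb] w /=; first by move->.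
case=> x [u [v [/IHa[u1 u2] /IHb[v1 v2] ->]]].
by rewrite /= !count_cat /= u1 u2 v1 v2; case: x => /=; lia.
Qed.

Lemma size_fits t w : fits t w -> size w = (nodes t).*2.
Proof.
case/count_fits => e1 e2; rewrite -(count_predC id w) e1 -addnn; congr (_ + _).
by rewrite -e2; apply: eq_count.
Qed.

Lemma nodes_tins t i : nodes (tins t i) = (nodes t).+1.
Proof. by elim: t i => [|a IHa b IHb] [|i] //=; case: leqP => _ /=; rewrite ?IHa ?IHb; lia. Qed.

Lemma fits_tins t i w : i <= (nodes t).*2 ->
  fits (tins t i) w <-> exists w' x, fits t w' /\ w = ins i x w'.
Proof.
elim: t i w => [|a IHa b IHb] i w.
  rewrite leqn0 => /eqP-> /=; split; first by case=> x [u [v [-> -> ->]]]; exists [::], x.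
  by case=> w' [x [-> ->]]; exists x, [::], [::].
case: i => [_|i il].
  rewrite [tins _ _]/=; split.
    by case=> x [u [v [-> h ->]]]; exists v, x; split=> //; rewrite /ins take0 drop0.
  by case=> v [x [h ->]]; exists x, [::], v; split=> //; rewrite /ins take0 drop0.
rewrite /=; case: leqP => ia.
  split.
    case=> y [u [v [/(IHa _ _ ia)[u' [x [hu ->]]] hv ->]]].
    exists (y :: u' ++ ~~ y :: v), x; split; first by exists y, u', v.
    by rewrite ins_cons ins_catl // (size_fits hu).
  case=> _ [x [[y [u [v [hu hv ->]]]] ->]].
  exists y, (ins i x u), v; split=> //; first by apply/IHa => //; exists u, x.
  by rewrite ins_cons ins_catl // (size_fits hu).
have ib : i - (nodes a).*2.+1 <= (nodes b).*2 by move: il => /=; lia.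
have e u v x y : size u = (nodes a).*2 -> ins i.+1 x (y :: u ++ ~~ y :: v) =
    y :: u ++ ~~ y :: ins (i - (nodes a).*2.+1) x v.
  move=> su; rewrite ins_cons ins_catr ?su; last exact: ltnW.
  by rewrite subnS -ins_cons prednK // subn_gt0.
split.
  case=> y [u [v [hu /(IHb _ _ ib)[v' [x [hv ->]]] ->]]].
  exists (y :: u ++ ~~ y :: v'), x; split; first by exists y, u, v'.
  by rewrite e // (size_fits hu).
case=> _ [x [[y [u [v [hu hv ->]]]] ->]].
exists y, u, (ins (i - (nodes a).*2.+1) x v); split=> //.
  by apply/IHb => //; exists v, x.
by rewrite e // (size_fits hu).
Qed.

Lemma fits_dyck x t : fits t (dyck x t).
Proof. by elim: t => //= a IHa b IHb; exists x, (dyck x a), (dyck x b). Qed.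

(** The walk of [dyck x s] stays on one side of its starting height and returns to it, so the next
    letter [~~ x] marks its end and the tree can be decoded. *)
Lemma dyck_inj x s t u v :
  dyck x s ++ ~~ x :: u = dyck x t ++ ~~ x :: v -> s = t /\ u = v.
Proof.
elim: s t u v => [|a IHa b IHb] [|a' b'] u v /=.
- by case.
- by case; case: (x).
- by case; case: (x).
case; rewrite -!catA /= => /IHa[->] /IHb[-> ->] //.
Qed.

(** For x true the walk starts at height at least 1 and never goes below its start; for x false it
    starts at height at most 0 and never goes above it. In both cases it avoids the step from 1 to
    0. *)
Lemma nocross_dyck x a b t : (b < a) = x -> nocross a b (dyck x t).
Proof.
elim: t a b => //= s IHs t IHt a b ex.
have [e1 e2] := count_fits (fits_dyck x s).
case: x ex IHs IHt e1 e2 => ex IHs IHt e1 e2 /=.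
  rewrite nocross_cat e1 e2 /= IHs; last by rewrite ltnS ltnW.
  by rewrite IHt; [rewrite andbT; lia | lia].
rewrite nocross_cat e1 e2 /= IHs; last by lia.
by rewrite IHt; [rewrite andbT; lia | lia].
Qed.

(* [s] and [t] encode the arcs before and after the unmatched point. *)
Definition matched s t w := exists u v, [/\ fits s u, fits t v & w = u ++ true :: v].

Definition balanced p w := size w = p.*2.+1 /\ count id w = p.+1.

Lemma matched_balanced s t w : matched s t w -> balanced (nodes s + nodes t) w.
Proof.
case=> u [v [hu hv ->]]; rewrite /balanced size_cat count_cat /=.
have [-> _] := count_fits hu; have [-> _] := count_fits hv.
by rewrite (size_fits hu) (size_fits hv); split; lia.
Qed.

(** The new arc joins adjacent points, so it falls entirely before or entirely after the unmatched
    point, which stays uncovered. *)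
Lemma matched_ins s t i : i < (nodes s + nodes t).+1.*2 ->
  exists s' t', nodes s' + nodes t' = (nodes s + nodes t).+1 /\
    forall w, matched s' t' w <-> exists w' x, matched s t w' /\ w = ins i x w'.
Proof.
move=> il; have [is_|si] := leqP i (nodes s).*2.
  exists (tins s i), t; split=> [|w]; first by rewrite nodes_tins addSn.
  split.
    case=> u [v [/fits_tins h hv ->]]; have [//|u' [x [hu ->]]] := h.
    by exists (u' ++ true :: v), x; rewrite ins_catl ?(size_fits hu) //; split=> //; exists u', v.
  case=> _ [x [[u [v [hu hv ->]]] ->]]; rewrite ins_catl ?(size_fits hu) //.
  by exists (ins i x u), v; split=> //; apply/fits_tins => //; exists u, x.
have jl : i - (nodes s).*2.+1 <= (nodes t).*2 by lia.
exists s, (tins t (i - (nodes s).*2.+1)); split=> [|w]; first by rewrite nodes_tins addnS.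
have e u v x : size u = (nodes s).*2 ->
    ins i x (u ++ true :: v) = u ++ true :: ins (i - (nodes s).*2.+1) x v.
  move=> su; rewrite ins_catr ?su; last exact: ltnW.
  by rewrite subnS -ins_cons prednK // subn_gt0.
split.
  case=> u [v [hu /fits_tins h ->]]; have [//|v' [x [hv ->]]] := h.
  by exists (u ++ true :: v'), x; rewrite e ?(size_fits hu) //; split=> //; exists u, v'.
case=> _ [x [[u [v [hu hv ->]]] ->]]; rewrite e ?(size_fits hu) //.
exists u, (ins (i - (nodes s).*2.+1) x v); split=> //.
by apply/fits_tins => //; exists v, x.
Qed.

Definition dyckword s t := dyck false s ++ true :: dyck true t.

Lemma matched_dyckword s t : matched s t (dyckword s t).
Proof. by exists (dyck false s), (dyck true t); split=> //; apply: fits_dyck. Qed.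

Lemma nocross_dyckword s t : nocross 0 0 (dyckword s t).
Proof.
rewrite /dyckword nocross_cat nocross_dyck //=.
have [-> ->] := count_fits (fits_dyck false s).
by apply: nocross_dyck; rewrite ltnS leqnn.
Qed.

Lemma dyckword_inj s t s' t' : dyckword s t = dyckword s' t' -> s = s' /\ t = t'.
Proof.
move=> /(@dyck_inj false)[-> e]; split=> //.
(* The appended [false] supplies the end marker; for the first half the middle [true] served. *)
by have [] := @dyck_inj true t t' [::] [::] (congr1 (cat^~ [:: false]) e).
Qed.

End Words.

(** * Splittings and words *)

Section Splittings.

Local Open Scope classical_set_scope.
Local Open Scope nat_scope.

Implicit Types (b y : seq nat) (w : seq bool) (p i k : nat).

Definition oddword b := [seq k \in oddpos b | k <- iota 0 (size b)].

Lemma ltn_sorted_uniq (s : seq nat) : sorted ltn s -> uniq s.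
Proof. exact: sorted_uniq ltn_trans ltnn s. Qed.

Lemma Aseq_mem p b k : Aseq p b -> (k \in b) = (k < p.*2.+1).
Proof. by case=> pb _ _; rewrite (perm_mem pb) mem_iota. Qed.

Lemma Aseq_size p b : Aseq p b -> size b = p.*2.+1.
Proof. by case=> /perm_size->; rewrite size_iota. Qed.

Lemma mem_rows (b : seq nat) k : (k \in b) = (k \in oddpos b) || (k \in evenpos b).
Proof. by rewrite -mem_cat (perm_mem (perm_rows b)). Qed.

Lemma Aseq_disj p b k : Aseq p b -> k \in oddpos b -> k \notin evenpos b.
Proof.
case=> pb _ _ ko; have : uniq (oddpos b ++ evenpos b).
  by rewrite (perm_uniq (perm_rows b)) (perm_uniq pb) iota_uniq.
by rewrite cat_uniq => /and3P[_ /hasPn h _]; apply: contraL ko => /h.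
Qed.

Lemma mem_oddpos p b k : Aseq p b -> (k \in oddpos b) = nth false (oddword b) k.
Proof.
move=> Ab; have [kb|kb] := ltnP k (size b).
  by rewrite (nth_map 0) ?size_iota // nth_iota.
rewrite [RHS]nth_default ?size_map ?size_iota //; apply/negbTE.
apply: contraL kb => ko; rewrite -ltnNge (Aseq_size Ab) -(Aseq_mem _ Ab).
by rewrite mem_rows ko.
Qed.

Lemma mem_evenpos p b k : Aseq p b ->
  (k \in evenpos b) = (k < p.*2.+1) && ~~ nth false (oddword b) k.
Proof.
move=> Ab; rewrite -(mem_oddpos _ Ab) -(Aseq_mem _ Ab) [in RHS](mem_rows b).
have := @Aseq_disj p b k Ab; case: (k \in oddpos b) => [/(_ isT)/negPf->|_] //=.
by rewrite andbT.
Qed.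

Lemma count_mem_iota (s : seq nat) k :
  uniq s -> count (mem s) (iota 0 k) = count (ltn^~ k) s.
Proof.
move=> us; rewrite -!size_filter; apply: perm_size.
apply: uniq_perm; rewrite ?filter_uniq ?iota_uniq // => z.
by rewrite !mem_filter mem_iota andbC.
Qed.

Lemma Aseq_rows_size p b : Aseq p b -> size (oddpos b) = p.+1 /\ size (evenpos b) = p.
Proof. by move=> /Aseq_size sb; rewrite !size_rows sb /= uphalf_double half_double. Qed.

Lemma oddword_balanced p b : Aseq p b -> balanced p (oddword b).
Proof.
move=> Ab; have sb := Aseq_size Ab; have [_ s1 _] := Ab.
rewrite /balanced /oddword size_map size_iota count_map; split=> //.
rewrite (@eq_count _ _ (mem (oddpos b))) // count_mem_iota ?ltn_sorted_uniq //.
have [<- _] := Aseq_rows_size Ab; apply/eqP; rewrite -all_count.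
by apply/allP => k ko /=; rewrite sb -(Aseq_mem _ Ab) mem_rows ko.
Qed.

Definition wordrow w x := [seq k <- iota 0 (size w) | nth false w k == x].
Definition wordseq w := alternate (wordrow w true) (wordrow w false).

Lemma size_wordrow w x : size (wordrow w x) = count_mem x w.
Proof.
rewrite size_filter; transitivity (count (preim (nth false w) (pred1 x)) (iota 0 (size w))) => //.
by rewrite -count_map -/(mkseq _ _) mkseq_nth.
Qed.

Lemma rows_wordseq p w : balanced p w ->
  oddpos (wordseq w) = wordrow w true /\ evenpos (wordseq w) = wordrow w false.
Proof.
case=> sw cw; have e1 : size (wordrow w true) = p.+1.
  by rewrite size_wordrow -cw; apply: eq_count; case.
have e2 : size (wordrow w false) = p.
  have := count_predC id w; rewrite cw sw size_wordrow.
  rewrite (@eq_count _ (pred1 false) (predC id)); last by case.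
  by set c := count _ _; lia.
by rewrite !rows_alternate // e1 e2 leqnSn leqnn.
Qed.

Lemma wordseqP p w : balanced p w -> Aseq p (wordseq w) /\ oddword (wordseq w) = w.
Proof.
move=> bw; have [e1 e2] := rows_wordseq bw.
have srt x : sorted ltn (wordrow w x).
  by apply: sorted_filter; [exact: ltn_trans | exact: iota_ltn_sorted].
have Aw : Aseq p (wordseq w).
  split; rewrite ?e1 ?e2 //.
  rewrite -(permPl (perm_rows _)) e1 e2 -(proj1 bw) /wordrow.
  rewrite (@eq_filter _ (fun k => nth false w k == false)
            (predC (fun k => nth false w k == true))).
    by rewrite perm_filterC.
  by move=> k /=; case: (nth _ _ _).
split=> //; apply: (@eq_from_nth _ false).
  by rewrite size_map size_iota (Aseq_size Aw); case: bw.
move=> k; rewrite -(mem_oddpos _ Aw) e1 mem_filter mem_iota /=.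
rewrite size_map size_iota (Aseq_size Aw) -(proj1 bw) => ->.
by rewrite andbT eqb_id.
Qed.

Lemma bump2E i k : bump i (bump i k) = if k < i then k else k.+2.
Proof. by rewrite /bump; case: ltnP => h; lia. Qed.

Lemma mem_map_bump2 i (s : seq nat) k :
  (k \in [seq bump i (bump i j) | j <- s]) =
  [&& k != i, k != i.+1 & (if k < i then k else k - 2) \in s].
Proof.
apply/mapP/and3P => [[j js ->]|[k1 k2 ks]]; rewrite ?bump2E.
  case: ltnP => ji; first by rewrite ji; split=> //; lia.
  by rewrite ltnNge (leq_trans ji) ?leqW //= subn2; split=> //; lia.
eexists; first exact: ks.
rewrite bump2E; case: (ltnP k i) => ki; first by rewrite ki.
by case: ifP => k3; lia.
Qed.

Lemma map_bump2_uniq i (s : seq nat) : uniq s -> uniq [seq bump i (bump i j) | j <- s].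
Proof. by rewrite map_inj_uniq // => a b; rewrite !bump2E; case: (ltnP a i); case: (ltnP b i); lia. Qed.

Definition realize p (W : seq bool -> Prop) : set (seq nat) :=
  [set b | Aseq p b /\ W (oddword b)].

Lemma Iop_ins p i (Y : set (seq nat)) b : Y `<=` Aseq p -> i < p.+1.*2 ->
  Iop p i Y b -> exists y x, Y y /\ oddword b = ins i x (oddword y).
Proof.
(* The inserted letters are true, false exactly when i itself goes to the odd row. *)
move=> YA ip [Ab [y Yy [t [u [tu po pe]]]]]; exists y, (t == i); split=> //.
have Ay := YA _ Yy; have [sy _] := oddword_balanced Ay.
apply: (@eq_from_nth _ false) => [|k _].
  rewrite size_cat /= size_takel ?size_drop ?sy; last by lia.
  by rewrite size_map size_iota (Aseq_size Ab); lia.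
rewrite -(mem_oddpos _ Ab) (perm_mem po) inE mem_map_bump2 nth_ins; last by rewrite sy; lia.
rewrite -!(mem_oddpos _ Ay).
by case: tu => -[-> _]; case: (ltngtP k i) => h; case: (ltngtP k i.+1) => h';
   rewrite ?andbF ?orbF //=; lia.
Qed.

(** Balance of the words in [W] is what allows the inclusion from right to left: such a word comes
    from the element [wordseq w] of A_p. *)
Lemma Iop_realize p i (W : seq bool -> Prop) :
  (forall w, W w -> balanced p w) -> i < p.+1.*2 ->
  Iop p i (realize p W) =
  realize p.+1 (fun w => exists w' x, W w' /\ w = ins i x w').
Proof.
move=> Wb ip; apply/seteqP; split=> [b Ib|b [Ab [w [x [Ww e]]]]].
  have [|y [x [[_ Wy] e]]] := @Iop_ins p i _ b _ ip Ib; first by move=> y [].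
  by split; [case: Ib | exists (oddword y), x].
split=> //; have [Ay ew] := wordseqP (Wb _ Ww).
exists (wordseq w); first by split; rewrite ?ew.
have iw : i <= size w by have [-> _] := Wb _ Ww; lia.
have [_ sb1 sb2] := Ab; have [_ sy1 sy2] := Ay.
have M k : nth false (oddword b) k = if k < i then nth false w k else
    if k == i then x else if k == i.+1 then ~~ x else nth false w (k - 2).
  by rewrite e nth_ins.
exists (if x then i else i.+1), (if x then i.+1 else i); split.
- by case: x {e M}; [left | right].
- apply: uniq_perm => [||k]; first exact: ltn_sorted_uniq.
    rewrite /= map_bump2_uniq ?ltn_sorted_uniq // andbT mem_map_bump2.
    by case: x {e M}; rewrite eqxx ?andbF.
  rewrite (mem_oddpos _ Ab) M inE mem_map_bump2 (mem_oddpos _ Ay) ew.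
  by case: x {e M}; case: (ltngtP k i) => h; case: (ltngtP k i.+1) => h';
    rewrite ?andbF ?orbF //=; lia.
apply: uniq_perm => [||k]; first exact: ltn_sorted_uniq.
  rewrite /= map_bump2_uniq ?ltn_sorted_uniq // andbT mem_map_bump2.
  by case: x {e M}; rewrite eqxx ?andbF.
rewrite (mem_evenpos _ Ab) M inE mem_map_bump2 (mem_evenpos _ Ay) ew.
by case: x {e M}; case: (ltngtP k i) => h; case: (ltngtP k i.+1) => h';
    rewrite ?andbF ?orbF //=; lia.
Qed.

Lemma Aseq0 : Aseq 0 = [set [:: 0]].
Proof.
by apply/seteqP; split=> [b [/perm_small_eq->]|_ ->].
Qed.

Lemma Ccoll_matched p Y : Ccoll p Y ->
  exists s t, nodes s + nodes t = p /\ Y = realize p (matched s t).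
Proof.
elim: p Y => [Y ->|p IH Y [i [Z [ip /IH[s [t [e ->]]] ->]]]].
  exists Leaf, Leaf; split=> //; rewrite /realize Aseq0.
  apply/seteqP; split=> [b /= ->|b []//]; split=> //.
  by exists [::], [::].
have [|s' [t' [e' h]]] := @matched_ins s t i; first by rewrite e.
exists s', t'; rewrite e' e; split=> //.
rewrite Iop_realize // => [|w /matched_balanced]; last by rewrite e.
by apply/seteqP; split=> b [Ab /h].
Qed.

Lemma rows_iota i m :
  {subset oddpos (iota i m) <= iota i m} /\ {subset evenpos (iota i m) <= iota i m}.
Proof. by split=> k h; rewrite -(perm_mem (perm_rows _)) mem_cat h ?orbT. Qed.

Lemma sorted_rows_iota i m :
  sorted ltn (oddpos (iota i m)) /\ sorted ltn (evenpos (iota i m)).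
Proof.
elim: m i => // m IH i.
rewrite -[iota _ _]/(i :: iota i.+1 m) oddpos_cons evenpos_cons.
have [so se] := IH i.+1; split=> //=.
rewrite (path_sortedE ltn_trans) se andbT; apply/allP => k.
by move=> /(rows_iota _ _).2; rewrite mem_iota => /andP[].
Qed.

Lemma Bcoll_Aseq p Y : Bcoll p Y -> Y `<=` Aseq p.
Proof.
case: p => [->//|p [->|[i [Z [_ _ ->]]]]] b; last by case.
move=> ->; have [so se] := sorted_rows_iota 0 p.+1.*2.+1.
by split.
Qed.

Lemma Bcoll_nocross p Y b :
  Bcoll p Y -> Y b -> nocross 0 0 (oddword b) -> Ccoll p Y.
Proof.
elim: p Y b => // p IH Y b [->|[i [Z [ip BZ ->]]]].
  move=> ->; rewrite /oddword size_iota doubleS.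
  (* The word of the singleton starts with true, false, hence with a step from 1 to 0. *)
  have [s -> /negPf s1] : exists2 s, oddpos (iota 0 p.*2.+3) = 0 :: s & 1 \notin s.
    exists (oddpos (iota 2 p.*2.+1)).
      by rewrite -[iota _ _]/[:: 0, 1 & iota 2 p.*2.+1] oddpos_cons evenpos_cons.
    by apply/negP => /(rows_iota _ _).1; rewrite mem_iota.
  by rewrite /= !inE s1.
move=> /(Iop_ins (Bcoll_Aseq BZ) ip)[y [x [Zy ->]]] /nocross_ins ny.
by exists i, Z; split=> //; apply: IH Zy ny.
Qed.

End Splittings.

(** * Descents *)

Section Descents.

Lemma count_ltn_nth (s : seq nat) i z : sorted ltn s -> i < size s ->
  (count (fun a => a < z) s <= i) = (z <= nth 0 s i).
Proof.
elim: s i => // a s IH i /= pas; have ss := path_sorted pas.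
have /allP h : all (ltn a) s by move: pas; rewrite (path_sortedE ltn_trans) => /andP[].
have c0 : z <= a -> count (fun a => a < z) s = 0.
  move=> za; apply/eqP; rewrite -leqn0 leqNgt -has_count; apply/hasPn => b /h ab.
  by rewrite -leqNgt (leq_trans za) // ltnW.
case: i => [_|i il] /=; first by case: (ltnP a z) => //= /c0->.
case: (ltnP a z) => [_|za]; first by rewrite add1n ltnS IH.
by rewrite c0 // (leq_trans za (ltnW (h _ (mem_nth 0 il)))).
Qed.

Lemma nth_rows (b : seq nat) j :
  nth 0 b j = nth 0 (if odd j then evenpos b else oddpos b) j./2.
Proof.
elim: b j => [|a b IH] j; first by case: odd; rewrite !nth_nil.
rewrite oddpos_cons evenpos_cons; case: j => //= j.
by rewrite IH uphalf_half; case: odd.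
Qed.

Lemma count_iota1_double (P : pred nat) p :
  count P (iota 1 p.*2) = \sum_(i < p) (P i.*2.+1 + P i.*2.+2).
Proof.
elim: p => [|p IH]; first by rewrite big_ord0.
rewrite big_ord_recr -IH doubleS -[X in iota 1 X]addn2 iotaD.
by rewrite count_cat /= addn0 add1n.
Qed.

Lemma sum_bool_eq (p : nat) (c : nat -> bool) :
  reflect (forall i, i < p -> c i) (\sum_(i < p) c i == p).
Proof.
have e : \sum_(i < p) c i + \sum_(i < p) ~~ c i = p.
  rewrite -big_split /= -[RHS](card_ord p) -sum1_card; apply: eq_bigr => i _.
  by case: (c i).
have -> : (\sum_(i < p) c i == p) = (\sum_(i < p) ~~ c i == 0) by lia.
rewrite sum_nat_eq0; apply: (iffP forallP) => [h i ip|h i].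
  by have := h (Ordinal ip) => /=; case: (c i).
by rewrite h.
Qed.

Lemma nocrossP a b (w : seq bool) : reflect
  (forall k, k < size w -> ~~ nth false w k ->
     a + count id (take k w) != (b + count negb (take k w)).+1)
  (nocross a b w).
Proof.
elim: w a b => [|x w IH] a b; first by apply: ReflectT.
case: x => /=.
  apply: (iffP (IH _ _)) => h.
    by case=> //= k kw nk; rewrite add0n addnA addn1 h.
  by move=> k kw nk; have := h k.+1 kw nk; rewrite /= add0n addnA addn1.
apply: (iffP andP) => [[h0 /IH h]|h].
  by case=> [|k] //= kw nk; rewrite ?addn0 // add0n addnA addn1 h.
split; first by have := h 0 isT isT; rewrite /= !addn0.
by apply/IH => k kw nk; have := h k.+1 kw nk; rewrite /= add0n addnA addn1.
Qed.

Definition descents (b : seq nat) (p : nat) :=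
  [seq j <- iota 1 p.*2 | nth 0 b j.-1 > nth 0 b j].

(** Exactly i even entries precede the even entry k of index i (from 0), so the height before k is 1
    when exactly i+1 odd entries are below k, that is, when k lies between the odd entries of
    indices i and i+1. *)
Lemma nocross_rows p b : Aseq p b -> reflect
  (forall i, i < p -> (nth 0 (evenpos b) i < nth 0 (oddpos b) i) ||
                      (nth 0 (oddpos b) i.+1 < nth 0 (evenpos b) i))
  (nocross 0 0 (oddword b)).
Proof.
move=> Ab; have [sO sE] := Aseq_rows_size Ab; have [_ oO oE] := Ab.
have [sw _] := oddword_balanced Ab; have sb := Aseq_size Ab.
have take_iota k : k <= p.*2.+1 -> take k (oddword b) = [seq j \in oddpos b | j <- iota 0 k].
  by move=> kp; rewrite /oddword -map_take take_iota sb (minn_idPl kp).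
have cO k : k <= p.*2.+1 ->
    count id (take k (oddword b)) = count (fun a => a < k) (oddpos b).
  move=> kp; rewrite take_iota // count_map -(count_mem_iota _ (ltn_sorted_uniq oO)).
  exact: eq_count.
have cE k : k <= p.*2.+1 ->
    count negb (take k (oddword b)) = count (fun a => a < k) (evenpos b).
  move=> kp; rewrite take_iota // count_map -(count_mem_iota _ (ltn_sorted_uniq oE)).
  apply: eq_in_count => j; rewrite mem_iota add0n => /andP[_ jk] /=.
  by rewrite (mem_evenpos _ Ab) (mem_oddpos _ Ab) (leq_trans jk kp).
have key i : i < p -> let k := nth 0 (evenpos b) i in
    [/\ k < p.*2.+1, ~~ nth false (oddword b) k &
    (count id (take k (oddword b)) != (count negb (take k (oddword b))).+1) =
      (k < nth 0 (oddpos b) i) || (nth 0 (oddpos b) i.+1 < k)].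
  move=> ip k; have kE : k \in evenpos b by rewrite mem_nth // sE.
  have := kE; rewrite (mem_evenpos _ Ab) => /andP[kp nk]; split=> //.
  rewrite cO ?cE; try exact: ltnW.
  have -> : count (fun a => a < k) (evenpos b) = i.
    have := @count_ltn_nth _ i k oE; rewrite sE -/k leqnn => /(_ ip) h1.
    case: (i) ip @k {kE kp nk} h1 => [|j] jp k h1; first by apply/eqP; rewrite -leqn0.
    have := @count_ltn_nth _ j k oE; rewrite sE => /(_ (ltnW jp)).
    have : nth 0 (evenpos b) j < k by have /(sortedP 0) := oE; apply; rewrite sE.
    by move: h1; lia.
  have kO : k \notin oddpos b by rewrite (mem_oddpos _ Ab).
  have d j : j < p.+1 -> k != nth 0 (oddpos b) j.
    by move=> jp; apply: contraNneq kO => ->; rewrite mem_nth // sO.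
  have := @count_ltn_nth _ i k oO; have := @count_ltn_nth _ i.+1 k oO.
  have := d i; have := d i.+1; rewrite sO; lia.
apply: (iffP (nocrossP _ _ _)) => h.
  by move=> i ip; have [k1 k2 <-] := key i ip; have := h _ _ k2; rewrite sw; apply.
move=> k; rewrite sw => kp nk.
have kE : k \in evenpos b by rewrite (mem_evenpos _ Ab) kp.
have ip : index k (evenpos b) < p by rewrite -sE index_mem.
have [_ _] := key _ ip; rewrite nth_index // => e.
by rewrite !add0n e -{1 4}(nth_index 0 kE) h.
Qed.

(** Positions 2i+1 and 2i+2 compare the even entry of index i with its two neighbours in the odd
    row. As these neighbours increase, at most one of the two is a descent, so p descents means one
    for each i. *)
Lemma size_descents p b : Aseq p b ->
  (size (descents b p) == p) = nocross 0 0 (oddword b).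
Proof.
move=> Ab; have [_ oO oE] := Ab; have [sO sE] := Aseq_rows_size Ab.
rewrite /descents size_filter count_iota1_double.
rewrite (eq_bigr (fun i : 'I_p => (nth 0 (evenpos b) i < nth 0 (oddpos b) i) ||
                      (nth 0 (oddpos b) i.+1 < nth 0 (evenpos b) i) : nat)).
  pose c i := (nth 0 (evenpos b) i < nth 0 (oddpos b) i) ||
              (nth 0 (oddpos b) i.+1 < nth 0 (evenpos b) i).
  exact: sameP (sum_bool_eq p c) (nocross_rows Ab).
move=> i _ /=; rewrite [nth 0 b i.*2]nth_rows [nth 0 b i.*2.+1]nth_rows [nth 0 b i.*2.+2]nth_rows.
rewrite /= negbK odd_double /= uphalf_double doubleK.
have : nth 0 (oddpos b) i < nth 0 (oddpos b) i.+1.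
  by have /(sortedP 0) := oO; apply; rewrite sO ltnS.
by case: (ltnP _ (nth 0 (oddpos b) i)); case: (ltnP (nth 0 (oddpos b) i.+1)) => //=; lia.
Qed.

End Descents.

(** * Words of symbols *)

Section SymbolWords.

Variable n : nat.
Implicit Types L : seq nat.

Definition oddsimple L := [seq a <- oddpos L | simple L a].
Definition evensimple L := [seq a <- evenpos L | simple L a].

Lemma symb_uniq L : symb n L -> uniq (oddpos L) /\ uniq (evenpos L).
Proof. by case/symb_rows => _ sO sE _ _; split; apply: ltn_sorted_uniq. Qed.

Lemma count_symb L a : symb n L ->
  count_mem a L = (a \in oddpos L) + (a \in evenpos L).
Proof.
move=> /symb_uniq[uO uE].
by rewrite -(seq.permP (perm_rows L)) count_cat !count_uniq_mem.
Qed.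

Lemma simple_rows L a : symb n L ->
  simple L a = (a \in oddpos L) (+) (a \in evenpos L).
Proof. by move=> sL; rewrite /simple count_symb //; do 2!case: (_ \in _). Qed.

(** The rows are strictly increasing, so a repeated entry occurs once in each of them. *)
Lemma perm_repeated L : symb n L ->
  perm_eq [seq a <- oddpos L | ~~ simple L a] [seq a <- evenpos L | ~~ simple L a].
Proof.
move=> sL; have [uO uE] := symb_uniq sL.
apply: uniq_perm; rewrite ?filter_uniq // => a; rewrite !mem_filter simple_rows //.
by case: (a \in oddpos L); case: (a \in evenpos L).
Qed.

Lemma size_simple_rows L : symb n L -> size (oddsimple L) = (size (evensimple L)).+1.
Proof.
move=> sL; have [sz _ _ _ _] := symb_rows sL; have := perm_size (perm_repeated sL).
have := count_predC (simple L) (oddpos L); have := count_predC (simple L) (evenpos L).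
rewrite /oddsimple /evensimple sz !size_filter.
rewrite -![count (predC _) _]/(count (fun a => ~~ simple L a) _).
by set c1 := count _ _; set c2 := count _ _; set c3 := count _ _; set c4 := count _ _; lia.
Qed.

Lemma rows_reduced L : symb n L ->
  oddpos (reduced L) = oddsimple L /\ evenpos (reduced L) = evensimple L.
Proof.
move=> sL; have := size_simple_rows sL; rewrite /reduced -/(oddsimple L) -/(evensimple L).
by move=> e; rewrite !rows_alternate // e leqnSn leqnn.
Qed.

Lemma size_reduced L : symb n L -> size (reduced L) = (psymb L).*2.+1.
Proof.
move=> sL; have [_ e] := rows_reduced sL.
have s : size (reduced L) = (size (evensimple L)).*2.+1.
  by rewrite size_mkseq size_simple_rows // addSn addnn.
by rewrite /psymb s /= uphalf_double.
Qed.

Lemma reduced_uniq L : symb n L -> uniq (reduced L).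
Proof.
move=> sL; have [uO uE] := symb_uniq sL; have [e1 e2] := rows_reduced sL.
rewrite -(perm_uniq (perm_rows _)) e1 e2 cat_uniq !filter_uniq //= andbT.
apply/hasPn => a; rewrite !mem_filter /= simple_rows //.
by case: (_ \in _); case: (_ \in _).
Qed.

Lemma perm_reduced L : symb n L -> perm_eq (reduced L) [seq a <- L | simple L a].
Proof.
move=> sL; have [e1 e2] := rows_reduced sL.
rewrite -(permPl (perm_rows _)) e1 e2 -filter_cat.
exact/perm_filter/perm_rows.
Qed.

(** These are the numbers z_0 < z_1 < ... < z_{2p}. *)
Definition spectrum L := sort leq (reduced L).

Lemma mem_spectrum L : spectrum L =i reduced L.
Proof. exact: mem_sort. Qed.

Lemma spectrum_uniq L : symb n L -> uniq (spectrum L).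
Proof. by move=> sL; rewrite sort_uniq reduced_uniq. Qed.

Lemma size_spectrum L : symb n L -> size (spectrum L) = (psymb L).*2.+1.
Proof. by move=> sL; rewrite size_sort size_reduced. Qed.

Lemma spectrum_sorted L : symb n L -> sorted ltn (spectrum L).
Proof.
by move=> sL; rewrite ltn_sorted_uniq_leq spectrum_uniq ?sort_sorted //; exact: leq_total.
Qed.

Lemma index_spectrum_mono L : symb n L ->
  {in reduced L &, {mono (index^~ (spectrum L)) : a b / a < b}}.
Proof.
move=> sL a b; rewrite -!mem_spectrum => Za Zb; apply/idP/idP => h.
  exact: (sorted_ltn_index ltn_trans (spectrum_sorted sL) a b Za Zb h).
rewrite ltnNge; apply: contraL h; rewrite -leqNgt.
apply: (sorted_leq_index leq_trans leqnn _ b a Zb Za).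
exact: sort_sorted leq_total _.
Qed.

Lemma rows_map (f : nat -> nat) (s : seq nat) :
  oddpos (map f s) = map f (oddpos s) /\ evenpos (map f s) = map f (evenpos s).
Proof.
elim: s => // a s [IH1 IH2].
by rewrite map_cons !oddpos_cons !evenpos_cons IH1 IH2.
Qed.

Lemma symb_perm_class L L0 : symb n L0 -> perm_eq L L0 ->
  sorted ltn (oddpos L) -> sorted ltn (evenpos L) -> symb n L.
Proof.
case=> h1 _ _ h4 h5 pL so se; split=> //.
- by rewrite (perm_size pL).
- by rewrite (perm_sumn pL) (perm_size pL).
by rewrite (seq.permP pL).
Qed.

Lemma eq_simple L L0 : perm_eq L L0 -> simple L =1 simple L0.
Proof. by move=> pL a; rewrite /simple (seq.permP pL). Qed.

Lemma perm_reduced_class L L0 : symb n L -> symb n L0 -> perm_eq L L0 ->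
  perm_eq (reduced L) (reduced L0).
Proof.
move=> sL sL0 pL; rewrite (permPl (perm_reduced sL)) (permPr (perm_reduced sL0)).
by rewrite (eq_filter (eq_simple pL)); apply: perm_filter.
Qed.

Lemma psymb_class L L0 : symb n L -> symb n L0 -> perm_eq L L0 -> psymb L = psymb L0.
Proof. by move=> sL sL0 pL; rewrite /psymb (perm_size (perm_reduced_class sL sL0 pL)). Qed.

Lemma bar_Aseq L : symb n L -> Aseq (psymb L) (bar L).
Proof.
move=> sL; have [_ sO sE _ _] := symb_rows sL; have [e1 e2] := rows_reduced sL.
have R k : k \in oddsimple L ++ evensimple L -> k \in reduced L.
  by rewrite -e1 -e2 (perm_mem (perm_rows _)).
have srt s : sorted ltn s -> {subset s <= reduced L} ->
    sorted ltn [seq index a (spectrum L) | a <- s].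
  move=> ss sR; apply: (homo_sorted_in _ _ ss); last exact/allP/sR.
  by move=> a b Ra Rb; rewrite /= index_spectrum_mono.
split.
- rewrite -size_spectrum // -map_index_uniq ?spectrum_uniq //.
  by apply: perm_map; rewrite perm_sym perm_sort.
- rewrite (rows_map _ _).1 e1; apply: srt => [|a aO].
    exact: sorted_filter ltn_trans _ _ sO.
  by apply: R; rewrite mem_cat aO.
rewrite (rows_map _ _).2 e2; apply: srt => [|a aE].
  exact: sorted_filter ltn_trans _ _ sE.
by apply: R; rewrite mem_cat aE orbT.
Qed.

(** Replacing the simple entries by their ranks preserves order, hence the descents. *)
Lemma Ssymb_nocross L : symb n L ->
  (size (Ssymb L) == psymb L) = nocross 0 0 (oddword (bar L)).
Proof.
move=> sL; rewrite -(size_descents (bar_Aseq sL)); congr (size _ == _).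
apply: eq_in_filter => j; rewrite mem_iota add1n ltnS => /andP[j0 jp].
have jR : j < size (reduced L) by rewrite size_reduced.
have jR' : j.-1 < size (reduced L) by apply: leq_ltn_trans jR; apply: leq_pred.
rewrite /bar (nth_map 0 0 _ jR) (nth_map 0 0 _ jR').
exact/esym/(index_spectrum_mono sL (mem_nth 0 jR) (mem_nth 0 jR')).
Qed.

(** The word distributes the simple entries between the rows; each row also receives one copy of
    every repeated entry and is then sorted. *)
Lemma bar_surj L0 w : symb n L0 -> balanced (psymb L0) w ->
  exists L, [/\ symb n L, perm_eq L L0 & oddword (bar L) = w].
Proof.
move=> sL0 [sw cw]; pose Z := spectrum L0.
pose D := [seq a <- oddpos L0 | ~~ simple L0 a].
pose row x := sort leq (mask [seq y == x | y <- w] Z ++ D).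
have Zu : uniq Z := spectrum_uniq sL0.
have sZ : size Z = size w by rewrite size_spectrum // sw.
have mT : [seq y == true | y <- w] = w by apply: map_id_in => -[].
have mF : [seq y == false | y <- w] = map negb w by apply: eq_map => -[].
have szT : size (mask w Z) = (psymb L0).+1 by rewrite size_mask.
have szF : size (mask (map negb w) Z) = psymb L0.
  rewrite size_mask ?size_map // count_map.
  have := count_predC id w; rewrite cw sw.
  rewrite (@eq_count _ (preim negb id) (predC id)) //.
  by set c := count _ _; lia.
have szr : size (row true) = (size (row false)).+1.
  by rewrite !size_sort !size_cat mT mF szT szF.
pose L := alternate (row true) (row false).
have [eO eE] : oddpos L = row true /\ evenpos L = row false.
  by rewrite /L !rows_alternate // szr leqnSn leqnn.
have simD : all (predC (simple L0)) D by apply: filter_all.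
have simZ m : all (simple L0) (mask m Z).
  apply/allP => a /mem_mask; rewrite mem_spectrum (perm_mem (perm_reduced sL0)).
  by rewrite mem_filter => /andP[].
have srt x : sorted ltn (row x).
  rewrite ltn_sorted_uniq_leq sort_uniq sort_sorted ?andbT; last exact: leq_total.
  have [uO _] := symb_uniq sL0.
  rewrite cat_uniq mask_uniq // filter_uniq // andbT /=.
  apply/hasPn => a /(allP simD) /= na.
  by apply: contra na => /(allP (simZ _)).
have pL : perm_eq L L0.
  rewrite -(permPl (perm_rows L)) eO eE -(permPr (perm_rows L0)).
  have [e1 e2] := rows_reduced sL0.
  rewrite -(permPr (perm_cat (permEl (perm_filterC (simple L0) _))
                             (permEl (perm_filterC (simple L0) _)))).
  rewrite -/(oddsimple L0) -/(evensimple L0) -e1 -e2.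
  rewrite (permPr (permEl (perm_catACA _ _ _ _))).
  have pD := perm_cat (perm_refl D) (perm_repeated sL0).
  rewrite -(permPr (perm_cat (perm_refl _) pD)).
  rewrite (permPl (perm_cat (permEl (perm_sort _ _)) (permEl (perm_sort _ _)))).
  rewrite (permPl (permEl (perm_catACA _ _ _ _))) perm_cat2r mT mF.
  rewrite (permPr (perm_rows _)) -(permPr (permEl (perm_sort leq _))) -/(spectrum L0) -/Z.
  (* It remains to see that complementary masks split [Z]. *)
  clear -sZ; elim: w Z sZ => [|x w IH] [|z Z] //= [/IH h].
  case: x => /=; first by rewrite perm_cons.
  by rewrite -cat1s perm_catCA /= perm_cons.
have sL : symb n L.
  by apply: (symb_perm_class sL0 pL); rewrite ?eO ?eE.
exists L; split=> //.
have eS : spectrum L = Z.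
  by apply/perm_sortP; [exact: leq_total | exact: leq_trans | exact: anti_leq |];
     exact: perm_reduced_class.
(* Filtering by [simple] discards [D], and what is left is already sorted. *)
have eT : oddsimple L = mask w Z.
  rewrite /oddsimple (eq_filter (eq_simple pL)) eO.
  rewrite filter_sort; [|exact: leq_total | exact: leq_trans].
  rewrite filter_cat mT; move/all_filterP: (simZ w) => ->.
  rewrite (eq_in_filter (a2 := pred0)) ?filter_pred0 ?cats0; last first.
    by move=> a /(allP simD) /negPf.
  apply: sorted_sort leq_trans _ _; apply: (sorted_mask leq_trans).
  exact: sort_sorted leq_total _.
have Ab := bar_Aseq sL.
have [sb _] := oddword_balanced Ab.
apply: (@eq_from_nth _ false) => [|k kb]; first by rewrite sb sw (psymb_class sL sL0 pL).
have kZ : k < size Z by rewrite sZ sw -(psymb_class sL sL0 pL) -sb.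
rewrite -(mem_oddpos _ Ab) (rows_map _ _).1 (rows_reduced sL).1 eT -/(spectrum L) eS.
apply/mapP/idP => [[a]|wk]; first by rewrite in_mask // => /andP[_ wa] ->.
by exists (nth 0 Z k); rewrite ?in_mask // ?mem_nth // index_uniq.
Qed.

End SymbolWords.

(** * The bracket *)

Section Families.

Import Order.TTheory GRing.Theory Num.Theory.
Local Open Scope classical_set_scope.
Local Open Scope ring_scope.

Variables (n : nat) (c : set 'CF(WB n)) (br : 'CF(WB n) -> 'CF(WB n)).

Lemma sumrep_dot_neq0 Y phi : '[sumrep c Y, phi] != 0 ->
  exists L, [/\ symb_of c L, Y (bar L) & '[Erep n L, phi] != 0].
Proof.
rewrite /sumrep cfdot_suml => nz; apply: contrapT => no; case/eqP: nz.
(* A sum with infinite support is 0 by convention. *)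
case: finite_supportP => [_|X XD _ _]; first by rewrite big_nil.
apply: big1_seq => L /andP[_ XL]; have [cL YL] := XD _ XL.
by apply/eqP/negP => /negP nz; apply: no; exists L.
Qed.

Hypotheses (famc : is_family c) (brc : is_bracket c br).

(** Distinct symbols with the same character would make it orthogonal to itself, hence 0, against
    its positive multiplicity in its bracket. *)
Lemma Erep_eq L L' : symb n L -> symb n L' -> c (Erep n L) ->
  Erep n L = Erep n L' -> L = L'.
Proof.
move=> sL sL' cL e; apply: contrapT => ne; have := brc.2 _ cL.
suff /eqP -> : Erep n L == 0 by rewrite cfdot0r ltxx.
by rewrite -cfnorm_eq0 {2}e Erep_ortho.
Qed.

Lemma symb_ofP : exists2 L0, symb n L0 &
  forall L, symb_of c L <-> symb n L /\ perm_eq L L0.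
Proof.
have [L0 sL0 ec] := famc; exists L0 => // L; split=> [[sL cL]|[sL pL]].
  split=> //; have := cL; rewrite ec => -[L1 [sL1 pL1] e].
  by rewrite (Erep_eq sL sL1 cL (esym e)).
by split=> //; rewrite ec; exists L.
Qed.

Lemma psymb_pfam L : symb_of c L -> psymb L = pfam c.
Proof.
move=> cL; have [L0 sL0 h] := symb_ofP.
have /h[s' p'] : symb_of c (xget [::] (symb_of c)) by apply: xgetPex; exists L.
have /h[sL pL] := cL.
by rewrite /pfam (psymb_class sL sL0 pL) (psymb_class s' sL0 p').
Qed.

Lemma symb_asP L : symb_of c L ->
  symb_as c L <-> nocross 0 0 (oddword (bar L)).
Proof.
move=> cL; rewrite -(Ssymb_nocross (proj1 cL)) (psymb_pfam cL).
by split=> [[_ ->]|/eqP].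
Qed.

(** Positive multiplicity yields a summand of the bracket not orthogonal to [Erep n L]; by
    orthogonality its symbol is [L] itself. *)
Lemma bracket_new L : symb_of c L ->
  exists Y, [/\ Bcoll (pfam c) Y, Y (bar L) & br (Erep n L) = sumrep c Y].
Proof.
move=> cL; have [[fb _ _] pos] := brc; have [sL EL] := cL.
have [Y BY eY] := fb _ EL; exists Y; split=> //.
have := pos _ EL; rewrite -eY => /lt0r_neq0/sumrep_dot_neq0[L' [[sL' cL'] YL' nz]].
suff -> : L = L' by [].
by apply: contrapT => ne; move: nz; rewrite Erep_ortho ?eqxx // => e; apply: ne.
Qed.

Lemma bracket_as L : symb_as c L -> Con c (br (Erep n L)).
Proof.
move=> aL; have cL := aL.1; have [Y [BY YL ->]] := bracket_new cL.
exists Y => //; apply: Bcoll_nocross BY YL _.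
exact/symb_asP.
Qed.

(** The symbols attached to a constructible [phi] through its matchings. This is a relation because
    [phi] is not known to determine s and t; [code_inj] gives the direction needed, that the symbol
    determines [phi]. *)
Definition code (phi : 'CF(WB n)) : set (seq nat) :=
  [set L | symb_as c L /\ exists s t, oddword (bar L) = dyckword s t /\
     phi = sumrep c (realize (pfam c) (matched s t))].

Lemma code_exists phi : Con c phi -> exists L, code phi L.
Proof.
case=> Y /Ccoll_matched[s [t [e ->]]] <-.
have [L0 sL0 h] := symb_ofP.
have c0 : symb_of c L0 by apply/h.
have bw : balanced (psymb L0) (dyckword s t).
  by rewrite (psymb_pfam c0) -e; apply/matched_balanced/matched_dyckword.
have [L [sL pL eL]] := bar_surj sL0 bw.
exists L; split; last by exists s, t.
have cL : symb_of c L by apply/h.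
by apply/symb_asP => //; rewrite eL nocross_dyckword.
Qed.

Lemma code_inj phi phi' L : code phi L -> code phi' L -> phi = phi'.
Proof.
by case=> _ [s [t [e ->]]] [_ [s' [t' []]]]; rewrite e => /dyckword_inj[-> ->] ->.
Qed.

Lemma bracket_as_inj L L' : symb_as c L -> symb_as c L' ->
  br (Erep n L) = br (Erep n L') -> L = L'.
Proof.
move=> [[sL cL] _] [[sL' cL'] _] e; apply: Erep_eq => //.
by have [[_ bi _] _] := brc; apply: bi; rewrite ?inE.
Qed.

Lemma bracket_as_surj phi : Con c phi -> exists2 L, symb_as c L & br (Erep n L) = phi.
Proof.
move=> Cphi; have [L0 sL0 h] := symb_ofP.
(* A finite list of the symbols with p descents, on which [f], the bracket followed by a choice of
   code, is an injective self-map, hence onto. *)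
pose xs := [seq L <- permutations L0 | `[< symb_as c L >]].
have xsE L : (L \in xs) <-> symb_as c L.
  rewrite mem_filter mem_permutations; split=> [/andP[/asboolP]//|aL].
  by apply/andP; split; [exact/asboolP | have /h[] := aL.1].
pose g psi := xget [::] (code psi).
have gP psi : Con c psi -> code psi (g psi) by move=> /code_exists; apply: xgetPex.
pose f L := g (br (Erep n L)).
have fP L : symb_as c L -> code (br (Erep n L)) (f L) by move=> /bracket_as/gP.
have uf : uniq (map f xs).
  rewrite map_inj_in_uniq ?filter_uniq ?permutations_uniq // => L L' /xsE aL /xsE aL' e.
  apply: bracket_as_inj => //; apply: code_inj (fP _ aL) _.
  by rewrite e; apply: fP.
have sf : {subset map f xs <= xs}.
  by move=> _ /mapP[L /xsE aL ->]; apply/xsE; have [] := fP _ aL.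
have [|_ ef] := uniq_min_size uf sf; first by rewrite size_map.
have [gas _] := gP _ Cphi.
have /mapP[L /xsE aL eL] : g phi \in map f xs by rewrite ef; apply/xsE.
by exists L => //; apply: code_inj (fP _ aL) _; rewrite -eL; apply: gP.
Qed.

End Families.

Local Open Scope classical_set_scope.

Theorem proposition1p5 (n : nat) (c : set 'CF(WB n))
    (br : 'CF(WB n) -> 'CF(WB n)) :
  (1 <= n)%N -> is_family c -> is_bracket c br ->
  set_bij (symb_as c) (Con c) (fun L => br (Erep n L))
  /\ fam_as c br = [set Erep n L | L in symb_as c].
Proof.
move=> _ famc brc; split.
  split=> [L|L L'|phi].
  - exact: bracket_as.
  - by rewrite !inE; apply: bracket_as_inj.
  - by move=> /(bracket_as_surj famc brc)[L aL <-]; exists L.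
apply/seteqP; split=> [E [cE CE]|_ [L aL <-]].
  have [L aL e] := bracket_as_surj famc brc CE; exists L => //.
  (* [E] and [Erep n L] have the same bracket, which is injective on [c]. *)
  have [[_ bi _] _] := brc; apply: bi => //; rewrite inE //.
  by have [[_ ]] := aL.
by split; [have [[]] := aL | exact: bracket_as].
Qed.
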